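(* For every real number $x \ge 2$, the interval $(x, x + 11x^{1/5}\log x]$ contains a squarefree integer.
   Context: An integer $n$ is squarefree if it is not divisible by $p^2$ for any prime $p$. Here $\log$ is the natural logarithm. *)

(* Defs.v *)
From Stdlib Require Import ZArith Znumtheory.

Open Scope Z_scope.

Definition squarefree (n : Z) : Prop :=
  forall p : Z, prime p -> ~ (p ^ 2 | n).

(* Main.v *)
Require Import Defs.
From Stdlib Require Import ZArith Znumtheory Reals.
From Stdlib Require Import Lra Lia Psatz List Permutation Sorted Mergesort Orders ClassicalEpsilon.

(** The argument is that of Filaseta and Trifonov with explicit constants. Put
    [h = 11 x^(1/5) ln x] and [w = x^(1/5)]. If [(x, x + h]] contains no squarefree integer, each of
    its integers is divisible by [p^2] for a prime [p]. Primes up to [z], about [h/4], account for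
    fewer than [(0.4585 + 1/15) h + O(1)] integers, so it suffices to show that few integers
    [u > z] have a multiple of [u^2] in the interval, i.e. have [x/u^2] just below an
    integer [m(u)].

    An integer combination of the [m(u_i)] that approximates a small positive multiple of a divided
    difference of [x/u^2] is positive, hence at least [1]; this forces points [u_i] apart. Two, three
    and four points give lower bounds for the span of order [u^3/x], [(u^4/x)^(1/3)] and
    [(u^5/x)^(1/6)]. Sums over all [u] are avoided by potential functions increasing by at least [1]
    along such a group of points. This settles [ln x <= 140], and in general the ranges
    [u <= w (ln x / 10)^6] and [u > w^2].

    In between, a point either has no other point within [(8/27) u/w] above it, which happens
    [O(w ln w)] times, or belongs to a pair [u, u + a] with small [a]. For given [a] the integer
    [det = (2u + 3a) m(u + a) - (2u - a) m(u)] is approximately [x a^3/u^4]. It takes at most about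
    [w/a] values, and the pairs with the same value [D] lie within [O(h/D)] of each other while any
    three of them are kept apart by the second difference of [m(u) - m(u + a)]. Summing over [D] and
    [a] again gives [O(w ln w)] plus a small multiple of [h]. *)

Open Scope R_scope.

(** * Counting integers with a given property *)

(** Counting goes through duplicate-free lists, so no finite set has to be constructed first; the
    bound is real so that analytic estimates combine directly. *)
Definition at_most (P : Z -> Prop) (r : R) : Prop :=
  forall l : list Z, NoDup l -> (forall u, In u l -> P u) -> INR (length l) <= r.

Definition Rlist_sum {A : Type} (f : A -> R) (l : list A) : R :=
  fold_right (fun i s => f i + s) 0 l.

(** A classical decision, for filtering lists by arbitrary predicates. *)
Definition truth (P : Prop) : bool :=
  if excluded_middle_informative P then true else false.

Lemma truth_true (P : Prop) : truth P = true <-> P.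
Proof. unfold truth; destruct (excluded_middle_informative P); intuition congruence. Qed.

Lemma at_most_mono (P Q : Z -> Prop) (r s : R) :
  (forall u, P u -> Q u) -> r <= s -> at_most Q r -> at_most P s.
Proof.
intros HPQ Hrs HQ l Hl Hin.
apply Rle_trans with r; [apply HQ|]; auto.
Qed.

Lemma at_most_or (P Q : Z -> Prop) (r s : R) :
  at_most P r -> at_most Q s -> at_most (fun u => P u \/ Q u) (r + s).
Proof.
intros HP HQ l Hl Hin.
rewrite <- (filter_length (fun u => truth (P u)) l), plus_INR.
apply Rplus_le_compat.
- apply HP; [now apply NoDup_filter|].
  intros u [_ Hu]%filter_In; now apply truth_true.
- apply HQ; [now apply NoDup_filter|].
  intros u [Hu HnP]%filter_In.
  destruct (Hin u Hu) as [Pu | Qu]; auto.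
  apply truth_true in Pu; rewrite Pu in HnP; discriminate.
Qed.

Lemma at_most_false (P : Z -> Prop) : (forall u, ~ P u) -> at_most P 0.
Proof.
intros HP [|u l] _ Hin; simpl; [lra|].
now destruct (HP u); apply Hin; left.
Qed.

Lemma at_most_sum {A : Type} (P : A -> Z -> Prop) (f : A -> R) (L : list A) :
  (forall i, In i L -> at_most (P i) (f i)) ->
  at_most (fun u => exists i, In i L /\ P i u) (Rlist_sum f L).
Proof.
induction L as [|i L IH]; intros H; simpl.
- apply at_most_false; firstorder.
- eapply at_most_mono; [| apply Rle_refl | apply at_most_or; [apply (H i)|apply IH]].
  + intros u (j & [<- | Hj] & Hu); [now left | right; now exists j].
  + now left.
  + intros j Hj; apply H; now right.
Qed.

Lemma Rlist_sum_app {A : Type} (f : A -> R) (l l' : list A) :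
  Rlist_sum f (l ++ l') = Rlist_sum f l + Rlist_sum f l'.
Proof. induction l as [|a l IH]; simpl; [ring | rewrite IH; ring]. Qed.

Lemma Rlist_sum_plus {A : Type} (f g : A -> R) (l : list A) :
  Rlist_sum (fun i => f i + g i) l = Rlist_sum f l + Rlist_sum g l.
Proof. induction l as [|a l IH]; simpl; [ring | rewrite IH; ring]. Qed.

Lemma Rlist_sum_scal {A : Type} (k : R) (f : A -> R) (l : list A) :
  Rlist_sum (fun i => k * f i) l = k * Rlist_sum f l.
Proof. induction l as [|a l IH]; simpl; [ring | rewrite IH; ring]. Qed.

Lemma Rlist_sum_const {A : Type} (k : R) (l : list A) :
  Rlist_sum (fun _ => k) l = INR (length l) * k.
Proof.
induction l as [|a l IH]; [simpl; ring|].
change (length (a :: l)) with (S (length l)); rewrite S_INR; simpl; rewrite IH; ring.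
Qed.

(** * Sorted lists and potential functions *)

Module ZTotalLe <: TotalLeBool'.
Definition t := Z.
Definition leb := Z.leb.
Infix "<=?" := leb.
Lemma leb_total (a b : Z) : (a <=? b) = true \/ (b <=? a) = true.
Proof. unfold leb; rewrite !Z.leb_le; lia. Qed.
End ZTotalLe.
Module ZSort := Sort ZTotalLe.

Lemma sorted_permutation (l : list Z) :
  NoDup l -> exists l', Permutation l l' /\ StronglySorted Z.lt l'.
Proof.
intros Hl; exists (ZSort.sort l); split; [apply ZSort.Permuted_sort|].
assert (Hnd : NoDup (ZSort.sort l))
  by (eapply Permutation_NoDup; [apply ZSort.Permuted_sort | exact Hl]).
assert (Hs : StronglySorted (fun a b => is_true (Z.leb a b)) (ZSort.sort l)).
{ apply ZSort.StronglySorted_sort; intros a b c; unfold ZTotalLe.leb, is_true.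
  rewrite !Z.leb_le; lia. }
induction Hs as [|a m Hm IH Ha]; constructor.
- apply IH; now inversion Hnd.
- rewrite Forall_forall in Ha |- *; intros b Hb.
  specialize (Ha b Hb); unfold is_true in Ha; apply Z.leb_le in Ha.
  inversion Hnd as [| ? ? Hna]; subst.
  destruct (Z.eq_dec a b); [subst; contradiction | lia].
Qed.

Lemma at_most_sorted (P : Z -> Prop) (r : R) :
  (forall l, StronglySorted Z.lt l -> (forall u, In u l -> P u) -> INR (length l) <= r) ->
  at_most P r.
Proof.
intros H l Hl Hin.
destruct (sorted_permutation l Hl) as (l' & Hp & Hs).
rewrite (Permutation_length Hp); apply H; auto.
intros u Hu; apply Hin; eapply Permutation_in; [apply Permutation_sym|]; eauto.
Qed.

Lemma sorted_cons (u : Z) (l : list Z) :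
  StronglySorted Z.lt (u :: l) ->
  StronglySorted Z.lt l /\ forall v, In v l -> (u < v)%Z.
Proof. intros H; inversion H; subst; rewrite Forall_forall in *; auto. Qed.

Lemma sorted_NoDup (l : list Z) : StronglySorted Z.lt l -> NoDup l.
Proof.
induction l as [|u l IH]; intros H; [constructor|].
apply sorted_cons in H as [Hs Hu]; constructor; auto.
intros Hin; specialize (Hu u Hin); lia.
Qed.

(** Along a sorted list [phi] gains 1 at every step but has only M - m available. *)
Lemma at_most_potential1 (P : Z -> Prop) (phi : Z -> R) (m M : R) :
  m <= M -> (forall u, P u -> m <= phi u <= M) ->
  (forall u v, P u -> P v -> (u < v)%Z -> phi u + 1 <= phi v) ->
  at_most P (1 + (M - m)).
Proof.
intros HmM Hr Hp; apply at_most_sorted; intros l Hs Hin.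
(* The inductive bound refers to the head of the list, described through [firstn 1 l] so that the
   empty list is covered vacuously. *)
assert (Hl : forall u, In u (firstn 1 l) -> INR (length l) <= 1 + (M - phi u)).
{ induction l as [|u l IH]; [easy|]; intros u' [<- | []].
  apply sorted_cons in Hs as [Hs Hu]; change (length (u :: l)) with (S (length l)); rewrite S_INR.
  destruct l as [|v l].
  - simpl; specialize (Hr u (Hin u (or_introl eq_refl))); lra.
  - assert (Hv := IH Hs (fun y Hy => Hin y (or_intror Hy)) v (or_introl eq_refl)).
    assert (phi u + 1 <= phi v) by (apply Hp; auto with datatypes).
    lra. }
destruct l as [|u l]; [simpl; lra|].
specialize (Hl u (or_introl eq_refl)).
specialize (Hr u (Hin u (or_introl eq_refl))); lra.
Qed.

Lemma sorted_induction (k : nat) (Q : list Z -> Prop) :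
  (0 < k)%nat ->
  (forall l, StronglySorted Z.lt l ->
     (forall l', (length l' + k = length l)%nat -> StronglySorted Z.lt l' ->
        (forall u, In u l' -> In u l) -> Q l') -> Q l) ->
  forall l, StronglySorted Z.lt l -> Q l.
Proof.
intros Hk H l; remember (length l) as n eqn:Hn; revert l Hn.
induction n as [n IH] using lt_wf_ind; intros l Hn Hs; apply H; auto.
intros l' Hl' Hs' _; apply (IH (length l')); auto; lia.
Qed.

(** Here [phi] gains 1 every two steps, so two points are removed at a time; the leading 1 pays for
    a last, incomplete group. *)
Lemma at_most_potential2 (P : Z -> Prop) (phi : Z -> R) (m M : R) :
  m <= M -> (forall u, P u -> m <= phi u <= M) ->
  (forall u v w, P u -> P v -> P w -> (u < v < w)%Z -> phi u + 1 <= phi w) ->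
  at_most P (2 * (1 + (M - m))).
Proof.
intros HmM Hr Hp; apply at_most_sorted; intros l Hs.
assert (Hl : (forall u, In u l -> P u) ->
  forall u, In u (firstn 1 l) -> INR (length l) <= 2 * (1 + (M - phi u))).
{ revert l Hs; apply (sorted_induction 2 (fun l => (forall u, In u l -> P u) ->
    forall u, In u (firstn 1 l) -> INR (length l) <= 2 * (1 + (M - phi u)))); [lia|].
  intros l Hs IH Hin u Hu.
  destruct l as [|u' l]; [easy|]; destruct Hu as [-> | []].
  assert (Ru := Hr u (Hin u (or_introl eq_refl))).
  destruct l as [|v l]; [simpl; lra|].
  destruct l as [|w l]; [simpl; lra|].
  apply sorted_cons in Hs as [Hs1 Hu]; apply sorted_cons in Hs1 as [Hs2 Hv].
  assert (Hw := IH (w :: l) ltac:(simpl; lia) Hs2 ltac:(intros y Hy; right; now right)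
    ltac:(intros y Hy; apply Hin; right; now right) w (or_introl eq_refl)).
  assert (phi u + 1 <= phi w).
  { apply Hp with v; auto with datatypes. }
  change (length (u :: v :: w :: l)) with (2 + length (w :: l))%nat.
  rewrite plus_INR; simpl (INR 2); lra. }
intros Hin; destruct l as [|u l]; [simpl; lra|].
specialize (Hl Hin u (or_introl eq_refl)).
specialize (Hr u (Hin u (or_introl eq_refl))); lra.
Qed.

Lemma at_most_potential3 (P : Z -> Prop) (phi : Z -> R) (m M : R) :
  m <= M -> (forall u, P u -> m <= phi u <= M) ->
  (forall u v w y, P u -> P v -> P w -> P y -> (u < v < w)%Z -> (w < y)%Z ->
     phi u + 1 <= phi y) ->
  at_most P (3 * (1 + (M - m))).
Proof.
intros HmM Hr Hp; apply at_most_sorted; intros l Hs.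
assert (Hl : (forall u, In u l -> P u) ->
  forall u, In u (firstn 1 l) -> INR (length l) <= 3 * (1 + (M - phi u))).
{ revert l Hs; apply (sorted_induction 3 (fun l => (forall u, In u l -> P u) ->
    forall u, In u (firstn 1 l) -> INR (length l) <= 3 * (1 + (M - phi u)))); [lia|].
  intros l Hs IH Hin u Hu.
  destruct l as [|u' l]; [easy|]; destruct Hu as [-> | []].
  assert (Ru := Hr u (Hin u (or_introl eq_refl))).
  destruct l as [|v l]; [simpl; lra|].
  destruct l as [|w l]; [simpl; lra|].
  destruct l as [|y l]; [simpl; lra|].
  apply sorted_cons in Hs as [Hs1 Hu]; apply sorted_cons in Hs1 as [Hs2 Hv].
  apply sorted_cons in Hs2 as [Hs3 Hw].
  assert (Hy := IH (y :: l) ltac:(simpl; lia) Hs3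
    ltac:(intros ? ?; right; right; now right)
    ltac:(intros ? ?; apply Hin; right; right; now right) y (or_introl eq_refl)).
  assert (phi u + 1 <= phi y).
  { apply Hp with v w; auto 8 with datatypes. }
  change (length (u :: v :: w :: y :: l)) with (3 + length (y :: l))%nat.
  rewrite plus_INR; simpl (INR 3); lra. }
intros Hin; destruct l as [|u l]; [simpl; lra|].
specialize (Hl Hin u (or_introl eq_refl)).
specialize (Hr u (Hin u (or_introl eq_refl))); lra.
Qed.

(** Every other element is kept, so a skipped one separates any two kept ones. *)
Lemma sorted_alternate (l : list Z) :
  StronglySorted Z.lt l ->
  exists l', (length l <= 2 * length l')%nat /\ NoDup l' /\
    (forall u, In u l' -> In u l) /\
    forall u v, In u l' -> In v l' -> (u < v)%Z ->
      exists y, In y l /\ (u < y < v)%Z.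
Proof.
revert l; apply (sorted_induction 2 (fun l => exists l',
  (length l <= 2 * length l')%nat /\ NoDup l' /\ (forall u, In u l' -> In u l) /\
    forall u v, In u l' -> In v l' -> (u < v)%Z ->
      exists y, In y l /\ (u < y < v)%Z)); [lia|].
intros l Hs IH.
destruct l as [|u l].
{ exists nil; simpl; repeat split; auto; [constructor | easy]. }
destruct l as [|y l].
{ exists (u :: nil); simpl; repeat split; auto.
  - constructor; [easy | constructor].
  - intros a b [<- | []] [<- | []] ?; lia. }
apply sorted_cons in Hs as [Hs1 Hu]; apply sorted_cons in Hs1 as [Hs2 Hy].
destruct (IH l ltac:(simpl; lia) Hs2 ltac:(intros ? ?; right; now right))
  as (l' & Hlen & Hnd & Hin & Hbt).
exists (u :: l'); repeat split.
- simpl; lia.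
- constructor; auto; intros Hul.
  assert (u < u)%Z by (apply Hu; right; auto); lia.
- intros a [<- | Ha]; [now left | right; right; auto].
- intros a b [<- | Ha] [<- | Hb] Hab; try lia.
  + exists y; split; [right; now left|]; split; [apply Hu; now left | apply Hy; auto].
  + assert (u < a)%Z by (apply Hu; right; auto); lia.
  + destruct (Hbt a b Ha Hb Hab) as (c & Hc & Habc); exists c; split; auto.
    right; now right.
Qed.

(** At the price of a factor 2, a relation between the outer two of three points becomes one between
    any two points. *)
Lemma at_most_alternate (P : Z -> Prop) (Rel : Z -> Z -> Prop) (r : R) :
  (forall u v w, P u -> P v -> P w -> (u < v < w)%Z -> Rel u w) ->
  (forall Q : Z -> Prop, (forall u, Q u -> P u) ->
     (forall u v, Q u -> Q v -> (u < v)%Z -> Rel u v) -> at_most Q r) ->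
  at_most P (2 * r).
Proof.
intros Htr HQ; apply at_most_sorted; intros l Hs Hin.
destruct (sorted_alternate l Hs) as (l' & Hlen & Hnd & Hin' & Hbt).
assert (Hr : INR (length l') <= r).
{ apply (HQ (fun u => In u l')); auto.
  intros u v Hu Hv Huv; destruct (Hbt u v Hu Hv Huv) as (y & Hy & Huyv).
  apply Htr with y; auto. }
apply le_INR in Hlen; rewrite mult_INR in Hlen; simpl (INR 2) in Hlen; lra.
Qed.

(** * Reduction to integers with a square multiple in the interval *)

(* Equivalently, x/u^2 lies below an integer by at most h/u^2. *)
Definition near (x h : R) (u : Z) : Prop :=
  (0 < u)%Z /\ exists m : Z, x < IZR m * IZR u ^ 2 <= x + h.

Lemma IZR_sq (v : Z) : IZR (v ^ 2) = IZR v ^ 2.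
Proof. now rewrite (pow_IZR v 2). Qed.

(** The potential n / v^2 grows by at least 1 between distinct multiples of v^2. *)
Lemma multiples_at_most (x h : R) (v : Z) :
  0 <= h -> (0 < v)%Z ->
  at_most (fun n => x < IZR n <= x + h /\ (v ^ 2 | n)%Z) (h * / IZR v ^ 2 + 1).
Proof.
intros Hh Hv; apply IZR_lt in Hv.
assert (Hv2 : 0 < / IZR v ^ 2) by (apply Rinv_0_lt_compat; nra).
apply at_most_mono with
  (Q := fun n => x < IZR n <= x + h /\ (v ^ 2 | n)%Z)
  (r := 1 + ((x + h) * / IZR v ^ 2 - x * / IZR v ^ 2)); [auto | lra |].
apply at_most_potential1 with (phi := fun n => IZR n * / IZR v ^ 2).
- nra.
- intros n [Hn _]; split; apply Rmult_le_compat_r; lra.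
- intros n n' [_ [k ->]] [_ [k' ->]] Hlt; rewrite !mult_IZR, IZR_sq.
  rewrite !Rmult_assoc, Rinv_r by nra.
  assert (Hk : (k < k')%Z) by nia.
  assert (Hk1 : (k + 1 <= k')%Z) by lia.
  apply IZR_le in Hk1; rewrite plus_IZR in Hk1; lra.
Qed.

(** * A wheel modulo 30 containing the primes *)

(** The classes coprime to 30, represented in the period from 7 to 36. Their translates by multiples
    of 30, together with 2, 3 and 5, contain all primes. *)
Definition residues : list Z := (7 :: 11 :: 13 :: 17 :: 19 :: 23 :: 29 :: 31 :: nil)%Z.

Fixpoint wheel (M : nat) : list Z :=
  match M with
  | O => nil
  | S M' => wheel M' ++ map (fun r => 30 * Z.of_nat M' + r)%Z residues
  end.

Lemma wheel_length (M : nat) : length (wheel M) = (8 * M)%nat.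
Proof. induction M as [|M IH]; simpl; [auto | rewrite length_app, IH; simpl; lia]. Qed.

Lemma wheel_pos (M : nat) (v : Z) : In v (wheel M) -> (0 < v)%Z.
Proof.
induction M as [|M IH]; cbn [wheel]; [easy|].
intros [H | H]%in_app_or; auto.
apply in_map_iff in H as (r & <- & Hr); simpl in Hr; lia.
Qed.

Lemma wheel_in (M : nat) (v : Z) :
  (7 <= v <= 30 * Z.of_nat M + 6)%Z ->
  (v mod 2 <> 0 -> v mod 3 <> 0 -> v mod 5 <> 0 -> In v (wheel M))%Z.
Proof.
intros Hv H2 H3 H5; induction M as [|M IH]; [lia|].
cbn [wheel]; apply in_or_app.
destruct (Z_le_gt_dec v (30 * Z.of_nat M + 6)) as [Hle | Hgt]; [left; apply IH; lia|right].
apply in_map_iff; exists (v - 30 * Z.of_nat M)%Z; split; [lia|].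
set (r := (v - 30 * Z.of_nat M)%Z).
assert (Hr : (7 <= r <= 36)%Z) by lia.
replace v with (r + 30 * Z.of_nat M)%Z in H2, H3, H5 by lia.
assert (R2 : (r mod 2 <> 0)%Z).
{ intros E; apply H2; rewrite Z.add_mod, E by lia.
  replace (30 * Z.of_nat M)%Z with (15 * Z.of_nat M * 2)%Z by lia.
  now rewrite Z.mod_mul by lia. }
assert (R3 : (r mod 3 <> 0)%Z).
{ intros E; apply H3; rewrite Z.add_mod, E by lia.
  replace (30 * Z.of_nat M)%Z with (10 * Z.of_nat M * 3)%Z by lia.
  now rewrite Z.mod_mul by lia. }
assert (R5 : (r mod 5 <> 0)%Z).
{ intros E; apply H5; rewrite Z.add_mod, E by lia.
  replace (30 * Z.of_nat M)%Z with (6 * Z.of_nat M * 5)%Z by lia.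
  now rewrite Z.mod_mul by lia. }
clearbody r; clear - Hr R2 R3 R5.
assert (Hc : (r = 7 \/ r = 8 \/ r = 9 \/ r = 10 \/ r = 11 \/ r = 12 \/ r = 13 \/ r = 14
  \/ r = 15 \/ r = 16 \/ r = 17 \/ r = 18 \/ r = 19 \/ r = 20 \/ r = 21 \/ r = 22 \/ r = 23
  \/ r = 24 \/ r = 25 \/ r = 26 \/ r = 27 \/ r = 28 \/ r = 29 \/ r = 30 \/ r = 31 \/ r = 32
  \/ r = 33 \/ r = 34 \/ r = 35 \/ r = 36)%Z) by lia.
unfold residues; simpl.
repeat (destruct Hc as [-> | Hc];
  [first [tauto | now destruct R2 | now destruct R3 | now destruct R5]|]).
subst; now destruct R2.
Qed.

Lemma wheel_prime (M : nat) (p : Z) :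
  prime p -> (p <= 30 * Z.of_nat M + 6)%Z -> In p (2 :: 3 :: 5 :: wheel M)%Z.
Proof.
intros Hp HpM; assert (Hp1 := prime_ge_2 p Hp).
assert (Hd : forall d : Z, prime d -> (p mod d = 0)%Z -> p = d).
{ intros d Hd E; assert (Hd2 := prime_ge_2 d Hd).
  symmetry; apply prime_div_prime; auto; apply Z.mod_divide; lia. }
assert (P5 : prime 5).
{ apply prime_intro; [lia|]; intros n Hn; apply Zgcd_1_rel_prime.
  assert (n = 1 \/ n = 2 \/ n = 3 \/ n = 4)%Z as [-> | [-> | [-> | ->]]] by lia; reflexivity. }
destruct (Z.eq_dec p 2) as [->|N2]; [now left|].
destruct (Z.eq_dec p 3) as [->|N3]; [right; now left|].
destruct (Z.eq_dec p 5) as [->|N5]; [right; right; now left|].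
right; right; right.
assert (p mod 2 <> 0)%Z by (intros E; apply N2, Hd; auto using prime_2).
assert (p mod 3 <> 0)%Z by (intros E; apply N3, Hd; auto using prime_3).
assert (p mod 5 <> 0)%Z by (intros E; apply N5, Hd; auto).
apply wheel_in; auto; split; auto.
destruct (Z.eq_dec p 4) as [->|N4]; [easy|].
destruct (Z.eq_dec p 6) as [->|N6]; [easy|]. lia.
Qed.

(** The right side is 1 / (a^2 - 15^2), written so that it telescopes when a advances by 30. *)
Lemma inv_sq_le (a b : R) : 15 < a -> a <= b ->
  / b ^ 2 <= / 30 * (/ (a - 15) - / (a + 15)).
Proof.
intros Ha Hab.
apply Rle_trans with (/ a ^ 2).
{ apply Rinv_le_contravar; nra. }
replace (/ 30 * (/ (a - 15) - / (a + 15))) with (/ ((a - 15) * (a + 15)))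
  by (field; lra).
apply Rinv_le_contravar; nra.
Qed.

(** The first block is summed explicitly to at most 0.0451. In each later block all eight terms are
    bounded by the smallest element, and the bounds telescope. *)
Lemma wheel_sum (M : nat) :
  Rlist_sum (fun v => / IZR v ^ 2) (wheel (S M))
  <= 0.0451 + 8 / 30 * (/ 22 - / (30 * INR M + 22)).
Proof.
induction M as [|M IH].
- simpl; lra.
- cbn [wheel] in IH |- *; rewrite Rlist_sum_app.
  set (P := Rlist_sum (fun v => / IZR v ^ 2)
    (wheel M ++ map (fun r => 30 * Z.of_nat M + r)%Z residues)) in IH |- *; clearbody P.
  set (s := INR M) in *; assert (Hs : 0 <= s) by apply pos_INR.
  rewrite S_INR; fold s.
  assert (Hr : forall r, 7 <= IZR r ->
    / IZR (30 * Z.of_nat (S M) + r) ^ 2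
    <= / 30 * (/ (30 * s + 22) - / (30 * (s + 1) + 22))).
  { intros r Hr7; rewrite plus_IZR, mult_IZR, <- INR_IZR_INZ, S_INR; fold s.
    replace (/ (30 * s + 22)) with (/ ((30 * s + 37) - 15)) by (f_equal; ring).
    replace (/ (30 * (s + 1) + 22)) with (/ ((30 * s + 37) + 15)) by (f_equal; ring).
    apply inv_sq_le; lra. }
  assert (Hall : Rlist_sum (fun v => / IZR v ^ 2)
      (map (fun r => 30 * Z.of_nat (S M) + r)%Z residues)
    <= 8 * (/ 30 * (/ (30 * s + 22) - / (30 * (s + 1) + 22)))).
  { unfold residues; cbn [map Rlist_sum fold_right].
    assert (H7 := Hr 7%Z ltac:(lra)); assert (H11 := Hr 11%Z ltac:(lra)).
    assert (H13 := Hr 13%Z ltac:(lra)); assert (H17 := Hr 17%Z ltac:(lra)).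
    assert (H19 := Hr 19%Z ltac:(lra)); assert (H23 := Hr 23%Z ltac:(lra)).
    assert (H29 := Hr 29%Z ltac:(lra)); assert (H31 := Hr 31%Z ltac:(lra)).
    lra. }
  lra.
Qed.

Lemma wheel_sum_le (M : nat) :
  Rlist_sum (fun v => / IZR v ^ 2) (2 :: 3 :: 5 :: wheel M)%Z <= 0.4585.
Proof.
assert (H : Rlist_sum (fun v => / IZR v ^ 2) (wheel M) <= 0.0573).
{ destruct M as [|M]; [simpl; lra|].
  assert (H := wheel_sum M).
  assert (0 <= / (30 * INR M + 22)).
  { assert (0 <= INR M) by apply pos_INR; left; apply Rinv_0_lt_compat; lra. }
  lra. }
change (/ 2 ^ 2 + (/ 3 ^ 2 + (/ 5 ^ 2 + Rlist_sum (fun v => / IZR v ^ 2) (wheel M))) <= 0.4585).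
lra.
Qed.

Lemma interval_integers (x h r : R) :
  0 <= h -> at_most (fun n => x < IZR n <= x + h) r -> h - 1 <= r.
Proof.
intros Hh H.
destruct (archimed x) as [Hx1 Hx2]; destruct (archimed h) as [Hh1 Hh2].
(* N <= h < N + 1, and the N integers up x, ..., up x + N - 1 lie in the half-open interval. *)
set (N := Z.to_nat (up h - 1)).
assert (Hup : (0 <= up h - 1)%Z).
{ apply Z.lt_succ_r; apply lt_IZR; unfold Z.succ; rewrite plus_IZR, minus_IZR; lra. }
assert (HN : INR N = IZR (up h) - 1).
{ unfold N; rewrite INR_IZR_INZ, Z2Nat.id, minus_IZR; auto. }
specialize (H (map (fun i => up x + Z.of_nat i)%Z (seq 0 N))).
rewrite length_map, length_seq in H.
apply Rle_trans with (INR N); [lra|]; apply H.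
- apply FinFun.Injective_map_NoDup; [intros i j; lia | apply seq_NoDup].
- intros n (i & <- & Hi)%in_map_iff; apply in_seq in Hi.
  rewrite plus_IZR, <- INR_IZR_INZ.
  assert (0 <= INR i) by apply pos_INR.
  assert (INR i + 1 <= INR N) by (rewrite <- S_INR; apply le_INR; lia).
  lra.
Qed.

(* Each v <= z accounts for at most h/v^2 + 1 integers of the interval, and each prime
   p > z for at most one, since p^2 > h. *)
Lemma sieve_wheel (x h z B : R) (M : nat) :
  0 < x -> 0 <= h -> 0 <= z <= 30 * INR M + 6 -> h <= z ^ 2 ->
  at_most (fun u => near x h u /\ z < IZR u) B ->
  0.4585 * h + 3 + 8 * INR M + B < h - 1 ->
  exists n : Z, x < IZR n <= x + h /\ squarefree n.
Proof.
intros Hx Hh [Hz0 HzM] Hhz HB Hlt.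
destruct (classic (exists n : Z, x < IZR n <= x + h /\ squarefree n)) as [|Hno]; [auto|].
exfalso.
assert (Hsq : forall n, x < IZR n <= x + h -> exists p, prime p /\ (p ^ 2 | n)%Z).
{ intros n Hn; apply NNPP; intros Hne; apply Hno; exists n; split; auto.
  intros p Hp Hd; apply Hne; now exists p. }
set (L := (2 :: 3 :: 5 :: wheel M)%Z).
set (I := fun n => x < IZR n <= x + h).
assert (HL : at_most (fun n => exists v, In v L /\ (I n /\ (v ^ 2 | n)%Z))
  (Rlist_sum (fun v => h * / IZR v ^ 2 + 1) L)).
{ apply at_most_sum; intros v Hv; apply multiples_at_most; auto.
  destruct Hv as [<- | [<- | [<- | Hv]]]; try lia; now apply wheel_pos in Hv. }
rewrite Rlist_sum_plus, Rlist_sum_scal, Rlist_sum_const in HL.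
assert (HW : Rlist_sum (fun v => / IZR v ^ 2) L <= 0.4585) by apply wheel_sum_le.
replace (INR (length L)) with (3 + 8 * INR M) in HL.
2:{ unfold L; cbn [length]; rewrite wheel_length, !S_INR, mult_INR; simpl; lra. }
assert (HP : at_most (fun n => I n /\ exists p, (prime p /\ z < IZR p) /\ (p ^ 2 | n)%Z) B).
{ intros l Hnd Hin.
  (* A choice of prime for each n. It is injective because two multiples of p^2 at distance less
     than h < p^2 coincide, so the bound B on near integers carries over to the n. *)
  set (g := fun n => epsilon (inhabits 0%Z)
                     (fun p => (prime p /\ z < IZR p) /\ (p ^ 2 | n)%Z)).
  assert (Hg : forall n, In n l -> (prime (g n) /\ z < IZR (g n)) /\ (g n ^ 2 | n)%Z).
  { intros n Hn; unfold g; apply epsilon_spec; now apply Hin. }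
  rewrite <- (length_map g); apply HB.
  - apply NoDup_map_NoDup_ForallPairs; auto.
    intros n n' Hn Hn' E.
    assert (Hgn := Hg n Hn); assert (Hgn' := Hg n' Hn'); rewrite <- E in Hgn'.
    destruct Hgn as [[Hp Hzp] [k Hk]]; destruct Hgn' as [_ [k' Hk']].
    destruct (Hin n Hn) as [In1 _]; destruct (Hin n' Hn') as [In2 _]; unfold I in *.
    apply f_equal with (f := IZR) in Hk, Hk'.
    rewrite mult_IZR in Hk, Hk'.
    rewrite IZR_sq in Hk, Hk'.
    set (q := IZR (g n)) in *.
    assert (Hq : h < q ^ 2) by nra.
    assert (k < k' + 1)%Z.
    { apply lt_IZR; rewrite plus_IZR; nra. }
    assert (k' < k + 1)%Z.
    { apply lt_IZR; rewrite plus_IZR; nra. }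
    assert (k = k') by lia; subst k'; apply eq_IZR; lra.
  - intros u (n & <- & Hn)%in_map_iff.
    destruct (Hg n Hn) as [[Hp Hzp] [k Hk]].
    assert (Hp2 := prime_ge_2 _ Hp).
    split; [split; [lia|] | auto].
    exists k; destruct (Hin n Hn) as [In1 _]; unfold I in In1.
    apply f_equal with (f := IZR) in Hk; rewrite mult_IZR in Hk.
    rewrite IZR_sq in Hk.
    rewrite <- Hk; auto. }
assert (HI := at_most_or _ _ _ _ HL HP).
assert (Hfin : h - 1 <= h * Rlist_sum (fun v => / IZR v ^ 2) L + (3 + 8 * INR M) * 1 + B).
{ apply interval_integers with x; auto.
  eapply at_most_mono; [| apply Rle_refl | exact HI].
  intros n Hn; destruct (Hsq n Hn) as (p & Hp & Hd).
  destruct (Rle_lt_dec (IZR p) z) as [Hpz | Hpz].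
  - left; exists p; split; [| split; auto].
    apply wheel_prime; auto.
    apply le_IZR; rewrite plus_IZR, mult_IZR, <- INR_IZR_INZ; lra.
  - right; split; auto; exists p; auto. }
nra.
Qed.

(** The least admissible number of blocks is at most (z - 6)/30 + 1, hence 8 M <= 8 z / 30 + 6.4;
    the 3 small primes and the loss of 1 in the interval count make 10.4. *)
Lemma sieve (x h z B : R) :
  0 < x -> 0 <= h -> 6 <= z -> h <= z ^ 2 ->
  at_most (fun u => near x h u /\ z < IZR u) B ->
  0.4585 * h + 8 / 30 * z + 10.4 + B < h ->
  exists n : Z, x < IZR n <= x + h /\ squarefree n.
Proof.
intros Hx Hh Hz Hhz HB Hlt.
destruct (archimed ((z - 6) / 30)) as [H1 H2].
assert (Hup : (0 <= up ((z - 6) / 30))%Z) by (apply le_IZR; lra).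
assert (HM : INR (Z.to_nat (up ((z - 6) / 30))) = IZR (up ((z - 6) / 30))).
{ rewrite INR_IZR_INZ, Z2Nat.id; auto. }
apply sieve_wheel with z B (Z.to_nat (up ((z - 6) / 30))); auto; rewrite ?HM; lra.
Qed.

(** * Divided differences on two, three and four points *)

Lemma near_theta (x h : R) (u : Z) :
  near x h u ->
  1 <= IZR u /\ exists m : Z, 0 < IZR m - x * / IZR u ^ 2 <= h * / IZR u ^ 2.
Proof.
intros [Hu (m & Hm)].
assert (HU : 1 <= IZR u) by (apply IZR_le; lia).
split; auto; exists m.
assert (Hi : 0 < / IZR u ^ 2) by (apply Rinv_0_lt_compat; nra).
replace (IZR m) with (IZR m * IZR u ^ 2 * / IZR u ^ 2) by (field; lra).
nra.
Qed.

Lemma near_sq_le (x h : R) (u : Z) : 0 < x -> near x h u -> IZR u ^ 2 <= x + h.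
Proof.
intros Hx [Hu (m & Hm)].
assert (HU : 1 <= IZR u) by (apply IZR_le; lia).
assert (0 < m)%Z.
{ apply lt_IZR; apply Rnot_le_lt; intros Hle; nra. }
assert (1 <= IZR m) by (apply IZR_le; lia).
nra.
Qed.

Lemma IZR_pos_ge1 (k : Z) : 0 < IZR k -> 1 <= IZR k.
Proof. intros H; apply IZR_le; apply lt_IZR in H; lia. Qed.

(** The condition on h u makes x/u^2 - x/v^2 at least h/v^2, so the cofactor of u exceeds that of v,
    hence by at least 1. *)
Lemma near_two (x h : R) (u v : Z) :
  0 < x -> 0 < h -> near x h u -> near x h v -> (u < v)%Z -> h * IZR u <= 2 * x ->
  1 - h * / IZR u ^ 2 <= x * / IZR u ^ 2 - x * / IZR v ^ 2.
Proof.
intros Hx Hh Nu Nv Huv Hhu.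
apply near_theta in Nu as (HU & m & Hm); apply near_theta in Nv as (HV & m' & Hm').
assert (HUV : IZR u + 1 <= IZR v) by (rewrite <- plus_IZR; apply IZR_le; lia).
set (U := IZR u) in *; set (V := IZR v) in *.
assert (H : h * / V ^ 2 <= x * / U ^ 2 - x * / V ^ 2).
{ replace (x * / U ^ 2 - x * / V ^ 2) with (x * (V ^ 2 - U ^ 2) * / U ^ 2 * / V ^ 2)
    by (field; lra).
  apply Rmult_le_compat_r; [left; apply Rinv_0_lt_compat; nra|].
  apply Rmult_le_reg_r with (U ^ 2); [nra|].
  rewrite Rmult_assoc, Rinv_l by nra.
  assert (x * (2 * U) <= x * (V ^ 2 - U ^ 2)) by (apply Rmult_le_compat_l; nra).
  nra. }
assert (1 <= IZR (m - m')) by (apply IZR_pos_ge1; rewrite minus_IZR; lra).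
rewrite minus_IZR in *; lra.
Qed.

(** The two-point bound of order u^3 / x, from [near_two] and u (u + v) <= 2 v^2. *)
Lemma near_two_gap (x h : R) (u v : Z) :
  0 < x -> 0 < h -> near x h u -> near x h v -> (u < v)%Z -> h * IZR u <= 2 * x ->
  h <= 0.001 * IZR u ^ 2 ->
  0.999 * IZR u ^ 3 <= 2 * x * (IZR v - IZR u).
Proof.
intros Hx Hh Nu Nv Huv Hhu Hs.
assert (K := near_two x h u v Hx Hh Nu Nv Huv Hhu).
apply near_theta in Nu as [HU _]; apply near_theta in Nv as [HV _].
assert (HUV : IZR u + 1 <= IZR v) by (rewrite <- plus_IZR; apply IZR_le; lia).
set (U := IZR u) in *; set (V := IZR v) in *.
assert (Hsm : h * / U ^ 2 <= 0.001).
{ apply Rmult_le_reg_r with (U ^ 2); [nra|].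
  rewrite Rmult_assoc, Rinv_l by nra; lra. }
assert (K2 : 0.999 * (U ^ 2 * V ^ 2) <= x * (V ^ 2 - U ^ 2)).
{ replace (x * (V ^ 2 - U ^ 2)) with ((x * / U ^ 2 - x * / V ^ 2) * (U ^ 2 * V ^ 2))
    by (field; lra).
  apply Rmult_le_compat_r; [nra | lra]. }
assert (HVU : U * (U + V) <= 2 * V ^ 2) by nra.
apply Rmult_le_reg_r with (V ^ 2); [nra|].
assert (x * (V - U) * (U * (U + V)) <= x * (V - U) * (2 * V ^ 2))
  by (apply Rmult_le_compat_l; [apply Rmult_le_pos; lra | auto]).
assert (0.999 * (U ^ 2 * V ^ 2) * U <= x * (V ^ 2 - U ^ 2) * U)
  by (apply Rmult_le_compat_r; lra).
nra.
Qed.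

(* What is needed of x and h = 11 x^(1/5) ln x for the divided difference estimates;
   it holds for ln x >= 42. *)
Definition regime (x h : R) : Prop := 20000 <= h /\ h ^ 3 <= 6 * x /\ 8e16 <= x.

Lemma regime_near (x h : R) (u : Z) :
  regime x h -> near x h u -> h / 4 <= IZR u ->
  h * IZR u <= 2 * x /\ h <= 0.001 * IZR u ^ 2 /\ 2e8 * IZR u <= x.
Proof.
intros (Hh & Hh3 & Hx) Nu Hz.
assert (HU2 := near_sq_le x h u ltac:(lra) Nu).
apply near_theta in Nu as [HU _]; set (U := IZR u) in *.
assert (Hhx : h ^ 2 <= 0.001 * x) by nra.
assert (HUx : U ^ 2 <= 2 * x) by nra.
assert (H3 : (2e8 * U) ^ 2 <= x ^ 2) by nra.
repeat split.
- apply Rsqr_incr_0_var; [unfold Rsqr|]; nra.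
- nra.
- apply Rsqr_incr_0_var; [unfold Rsqr|]; nra.
Qed.

(** Writes inverses of nearby points as multiples of 1/U, so that main terms become a power of 1/U
    times a factor close to a constant. *)
Lemma inv_ratio (U W : R) :
  0 < U -> U <= W -> W - U <= U / 500 ->
  exists r, / W = r * / U /\ 0.998 <= r <= 1.
Proof.
intros HU HUW HW; exists (U / W); split; [field; lra|]; split.
- apply Rmult_le_reg_r with W; [lra|]; unfold Rdiv; rewrite Rmult_assoc, Rinv_l by lra; lra.
- apply Rmult_le_reg_r with W; [lra|]; unfold Rdiv; rewrite Rmult_assoc, Rinv_l by lra; lra.
Qed.

(* Clearing denominators, V = (u2 - u1)(u3 - u2)(u3 - u1) times the second divided difference
   of the cofactors m_i is an integer I. It is close to V times the divided difference of
   x/u^2, which is x V w1 w2 w3 (w1 + w2 + w3) with w_i = 1/u_i; this main term dominates the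
   negative part of the error, so I > 0, hence I >= 1. *)
Lemma near_three_close (x h : R) (u1 u2 u3 : Z) :
  regime x h -> near x h u1 -> near x h u2 -> near x h u3 ->
  (u1 < u2 < u3)%Z -> h / 4 <= IZR u1 -> IZR u3 - IZR u1 <= IZR u1 / 500 ->
  0.33 * IZR u1 ^ 4
  <= x * ((IZR u2 - IZR u1) * (IZR u3 - IZR u2) * (IZR u3 - IZR u1)).
Proof.
intros Hr N1 N2 N3 Hu Hz Hcl.
assert (HUV : IZR u1 + 1 <= IZR u2) by (rewrite <- plus_IZR; apply IZR_le; lia).
assert (HVW : IZR u2 + 1 <= IZR u3) by (rewrite <- plus_IZR; apply IZR_le; lia).
destruct (regime_near x h u1 Hr N1 Hz) as (A1 & B1 & _).
destruct (regime_near x h u2 Hr N2 ltac:(lra)) as (A2 & B2 & _).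
destruct Hr as (Hh & Hh3 & Hx).
assert (G1 := near_two_gap x h u1 u2 ltac:(lra) ltac:(lra) N1 N2 ltac:(lia) A1 B1).
assert (G2 := near_two_gap x h u2 u3 ltac:(lra) ltac:(lra) N2 N3 ltac:(lia) A2 B2).
apply near_theta in N1 as (HU1 & m1 & T1); apply near_theta in N2 as (HU2 & m2 & T2).
apply near_theta in N3 as (HU3 & m3 & T3).
set (I := ((u3 - u2) * m1 - (u3 - u1) * m2 + (u2 - u1) * m3)%Z).
assert (EI : IZR I = (IZR u3 - IZR u2) * IZR m1 - (IZR u3 - IZR u1) * IZR m2
  + (IZR u2 - IZR u1) * IZR m3)
  by (unfold I; rewrite plus_IZR, minus_IZR, !mult_IZR, !minus_IZR; ring).
assert (HI1 : 0 < IZR I -> 1 <= IZR I) by apply IZR_pos_ge1.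
rewrite EI in HI1; clear EI I.
set (U := IZR u1) in *; set (V := IZR u2) in *; set (W := IZR u3) in *.
destruct (inv_ratio U V ltac:(lra) ltac:(lra) ltac:(lra)) as (r & Er & Hr1).
destruct (inv_ratio U W ltac:(lra) ltac:(lra) ltac:(lra)) as (s & Es & Hs1).
rewrite <- !pow_inv in T1, T2, T3.
assert (E : (W - V) * / U ^ 2 - (W - U) * / V ^ 2 + (V - U) * / W ^ 2
  = (V - U) * (W - V) * (W - U) * (/ U * / V * / W * (/ U + / V + / W)))
  by (field; lra).
rewrite <- !pow_inv in E.
rewrite Er, Es in *.
set (w := / U) in *.
assert (Hw : 0 < w) by (apply Rinv_0_lt_compat; lra).
assert (HwU : w * U = 1) by (apply Rinv_l; lra).
set (a := V - U) in *; set (b := W - V) in *.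
assert (Eab : W - U = a + b) by (unfold a, b; ring); rewrite Eab in *.
replace (w * (r * w) * (s * w) * (w + r * w + s * w))
  with (w ^ 4 * (r * s * (1 + r + s))) in E by ring.
assert (Hp : 2.97 <= r * s * (1 + r + s) <= 3) by nra.
set (p := r * s * (1 + r + s)) in *.
assert (Ha : 1 <= a) by (unfold a; lra); assert (Hb : 1 <= b) by (unfold b; lra).
set (t1 := IZR m1 - x * w ^ 2) in *.
set (t2 := IZR m2 - x * (r * w) ^ 2) in *.
set (t3 := IZR m3 - x * (s * w) ^ 2) in *.
replace (b * IZR m1 - (a + b) * IZR m2 + a * IZR m3)
  with (x * (a * b * (a + b) * (w ^ 4 * p)) + (b * t1 - (a + b) * t2 + a * t3)) in HI1
  by (rewrite <- E; unfold t1, t2, t3; ring).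
(* If h U^2 <= 2.97 x, then a b >= 1 suffices. Otherwise both gaps are at least 0.999 U^3 / (2 x),
   and h^3 <= 6 x gives h x <= 0.74 U^4, where 0.74 is just below 2.97 * 0.999^2 / 4. *)
assert (Hpos : h * U ^ 2 <= 2.97 * (x * (a * b))).
{ destruct (Rle_lt_dec (h * U ^ 2) (2.97 * x)) as [Hle | Hgt].
  - assert (1 <= a * b) by nra; nra.
  - assert (Hb' : 0.999 * U ^ 3 <= 2 * x * b).
    { assert (U ^ 3 <= V ^ 3) by (apply pow_incr; lra); lra. }
    assert (HU3' : 0 < U ^ 3) by (apply pow_lt; lra).
    assert (Hab : (0.999 * U ^ 3) * (0.999 * U ^ 3) <= (2 * x * a) * (2 * x * b))
      by (apply Rmult_le_compat; lra).
    assert (K1 : (2.97 * x) * (2.97 * x) <= (h * U ^ 2) * (h * U ^ 2))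
      by (apply Rmult_le_compat; lra).
    assert (K2 : h ^ 3 * x <= 6 * x * x) by (apply Rmult_le_compat_r; lra).
    assert (K3 : h * x <= 0.74 * U ^ 4).
    { apply Rmult_le_reg_l with (h ^ 2); [nra|]; nra. }
    assert (K4 : h * x * U ^ 2 <= 0.74 * U ^ 4 * U ^ 2)
      by (apply Rmult_le_compat_r; [nra | lra]).
    apply Rmult_le_reg_l with x; [lra|]; nra. }
assert (Hr2 : r ^ 2 <= 1) by nra; assert (Hs2 : s ^ 2 <= 1) by nra.
assert (Hhw : 0 < h * w ^ 2) by (apply Rmult_lt_0_compat; [lra | apply pow_lt; lra]).
assert (Ht2 : t2 <= h * w ^ 2) by nra.
assert (Ht3 : t3 <= h * w ^ 2) by nra.
assert (Hmain : h * w ^ 2 <= x * (a * b * (w ^ 4 * p))).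
{ replace (h * w ^ 2) with (h * U ^ 2 * w ^ 4)
    by (replace (h * U ^ 2 * w ^ 4) with (h * w ^ 2 * (w * U) ^ 2) by ring; rewrite HwU; ring).
  replace (x * (a * b * (w ^ 4 * p))) with (x * (a * b) * p * w ^ 4) by ring.
  apply Rmult_le_compat_r; [left; apply pow_lt; lra|].
  assert (0 < x * (a * b)) by (apply Rmult_lt_0_compat; [lra | apply Rmult_lt_0_compat; lra]).
  assert (x * (a * b) * 2.97 <= x * (a * b) * p) by (apply Rmult_le_compat_l; lra).
  lra. }
assert (HIpos : 0 < x * (a * b * (a + b) * (w ^ 4 * p)) + (b * t1 - (a + b) * t2 + a * t3)).
{ assert (h * w ^ 2 * (a + b) <= x * (a * b * (w ^ 4 * p)) * (a + b))
    by (apply Rmult_le_compat_r; lra).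
  assert (0 < b * t1) by (apply Rmult_lt_0_compat; lra).
  assert (0 < a * t3) by (apply Rmult_lt_0_compat; lra).
  assert ((a + b) * t2 <= (a + b) * (h * w ^ 2)) by (apply Rmult_le_compat_l; lra).
  nra. }
specialize (HI1 HIpos).
(* Span at most U/500 and h <= 4 U give (U/500) h / U^2 <= 4/500. The main term is then at least
   0.992, and division by 3 leaves 0.33. *)
assert (Herr : b * t1 - (a + b) * t2 + a * t3 <= 0.008).
{ assert (b * t1 <= b * (h * w ^ 2)) by (apply Rmult_le_compat_l; lra).
  assert (a * t3 <= a * (h * w ^ 2)) by (apply Rmult_le_compat_l; lra).
  assert (0 <= (a + b) * t2) by (apply Rmult_le_pos; lra).
  assert ((a + b) * (h * w ^ 2) <= U / 500 * (h * w ^ 2)) by (apply Rmult_le_compat_r; lra).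
  replace (U / 500 * (h * w ^ 2)) with (w * h / 500 * (w * U)) in * by field.
  rewrite HwU in *.
  assert (w * h <= w * (4 * U)) by (apply Rmult_le_compat_l; lra).
  nra. }
assert (HwU4 : w ^ 4 * U ^ 4 = 1) by (rewrite <- Rpow_mult_distr, HwU; ring).
assert (0.992 * U ^ 4 <= x * (a * b * (a + b) * (w ^ 4 * p)) * U ^ 4)
  by (apply Rmult_le_compat_r; [apply pow_le |]; lra).
replace (x * (a * b * (a + b) * (w ^ 4 * p)) * U ^ 4)
  with (x * (a * b * (a + b)) * p * (w ^ 4 * U ^ 4)) in * by ring.
rewrite HwU4 in *.
assert (0 < x * (a * b * (a + b))) by (apply Rmult_lt_0_compat; [lra|]; nra).
nra.
Qed.

(* 1.3 is just below 4 * 0.33, with 0.33 from near_three_close, as 4 a b (a + b) <= (a + b)^3. *)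
Definition spaced (x : R) (u v : Z) : Prop :=
  1.3 * IZR u ^ 4 <= x * (IZR v - IZR u) ^ 3.

(** Close points are covered by [near_three_close]; a span above u1/500 is enough by itself because
    x >= 2e8 u1. *)
Lemma near_three (x h : R) (u1 u2 u3 : Z) :
  regime x h -> near x h u1 -> near x h u2 -> near x h u3 ->
  (u1 < u2 < u3)%Z -> h / 4 <= IZR u1 -> spaced x u1 u3.
Proof.
intros Hr N1 N2 N3 Hu Hz; unfold spaced.
destruct (regime_near x h u1 Hr N1 Hz) as (_ & _ & C1).
assert (HU1 := proj1 (near_theta _ _ _ N1)).
assert (Hx : 0 < x) by (destruct Hr; lra).
assert (HUV : IZR u1 + 1 <= IZR u2) by (rewrite <- plus_IZR; apply IZR_le; lia).
assert (HVW : IZR u2 + 1 <= IZR u3) by (rewrite <- plus_IZR; apply IZR_le; lia).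
destruct (Rle_lt_dec (IZR u3 - IZR u1) (IZR u1 / 500)) as [Hle | Hgt].
- assert (H := near_three_close x h u1 u2 u3 Hr N1 N2 N3 Hu Hz Hle).
  set (U := IZR u1) in *; set (V := IZR u2) in *; set (W := IZR u3) in *.
  assert (4 * ((V - U) * (W - V)) <= (W - U) ^ 2).
  { assert (0 <= ((V - U) - (W - V)) ^ 2) by apply pow2_ge_0; nra. }
  assert (4 * ((V - U) * (W - V)) * (W - U) <= (W - U) ^ 2 * (W - U))
    by (apply Rmult_le_compat_r; lra).
  assert (x * (4 * ((V - U) * (W - V)) * (W - U)) <= x * ((W - U) ^ 2 * (W - U)))
    by (apply Rmult_le_compat_l; lra).
  assert (0 <= U ^ 4) by (apply pow_le; lra).
  nra.
- set (U := IZR u1) in *; set (W := IZR u3) in *.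
  assert ((U / 500) ^ 3 <= (W - U) ^ 3) by (apply pow_incr; lra).
  assert (HU3 : 0 < U ^ 3) by (apply pow_lt; lra).
  apply Rle_trans with (x * (U / 500) ^ 3); [| apply Rmult_le_compat_l; lra].
  replace (x * (U / 500) ^ 3) with (x / 125000000 * U ^ 3) by field.
  replace (1.3 * U ^ 4) with (1.3 * U * U ^ 3) by ring.
  apply Rmult_le_compat_r; lra.
Qed.

(* The extremal configuration is a = c and b = (a + b + c) / sqrt 5. *)
Lemma vandermonde4_le (a b c : R) :
  0 < a -> 0 < b -> 0 < c ->
  a * b * c * (a + b) * (b + c) * (a + b + c) <= 0.018 * (a + b + c) ^ 6.
Proof.
intros Ha Hb Hc; set (L := a + b + c).
assert (HL : 0 < L) by (unfold L; lra).
assert (Hac : a * c <= (L - b) ^ 2 / 4).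
{ assert (0 <= (a - c) ^ 2) by apply pow2_ge_0; unfold L; nra. }
assert (Hout : (a + b) * (b + c) <= (L + b) ^ 2 / 4).
{ replace ((a + b) * (b + c)) with (b * L + a * c) by (unfold L; ring). nra. }
assert (H1 : a * c * ((a + b) * (b + c)) <= (L - b) ^ 2 / 4 * ((L + b) ^ 2 / 4))
  by (apply Rmult_le_compat; nra).
assert (HbL : 0 < b < L) by (unfold L; lra).
assert (Hy : 0 <= 0.288 * L ^ 5 - b * (L ^ 2 - b ^ 2) ^ 2).
{ replace b with (b / L * L) by (field; lra).
  set (y := b / L).
  assert (Hy : 0 < y < 1).
  { split; [apply Rdiv_lt_0_compat; lra|].
    apply Rmult_lt_reg_r with L; [lra|]; unfold y, Rdiv.
    rewrite Rmult_assoc, Rinv_l by lra; lra. }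
  replace (0.288 * L ^ 5 - y * L * (L ^ 2 - (y * L) ^ 2) ^ 2)
    with (L ^ 5 * (0.288 - y * (1 - y ^ 2) ^ 2)) by ring.
  apply Rmult_le_pos; [apply pow_le; lra|].
  (* The maximum of y (1 - y^2)^2 on (0, 1) is about 0.2862, at y = 1 / sqrt 5, or about 0.4472. The
     second factor is the quotient by this double root; 0.018 is 0.288 / 16. *)
  assert (0 <= (y - 0.4472) ^ 2 * (1.43104 + 1.4 * y - 0.8944 * y ^ 2 - y ^ 3)).
  { apply Rmult_le_pos; [apply pow2_ge_0 | nra]. }
  nra. }
replace (a * b * c * (a + b) * (b + c) * L) with (b * L * (a * c * ((a + b) * (b + c))))
  by (unfold L; ring).
apply Rle_trans with (b * L * ((L - b) ^ 2 / 4 * ((L + b) ^ 2 / 4))).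
{ apply Rmult_le_compat_l; [nra | auto]. }
replace (b * L * ((L - b) ^ 2 / 4 * ((L + b) ^ 2 / 4)))
  with (L / 16 * (b * (L ^ 2 - b ^ 2) ^ 2)) by field.
replace (0.018 * L ^ 6) with (L / 16 * (0.288 * L ^ 5)) by lra.
apply Rmult_le_compat_l; lra.
Qed.

(** With g the least gap, a lower bound for g^3 passes to every product of three gaps. *)
Lemma cube_mul_le (k x g a b c : R) :
  0 < x -> 0 < g -> k <= x * g ^ 3 -> g <= a -> g <= b -> g <= c -> k <= x * (a * b * c).
Proof.
intros Hx Hg Hk Ha Hb Hc; apply Rle_trans with (x * g ^ 3); auto.
apply Rmult_le_compat_l; [lra|].
replace (g ^ 3) with (g * g * g) by ring.
apply Rmult_le_compat; try nra; apply Rmult_le_compat; lra.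
Qed.

Lemma four_mul_le (a b : R) : 4 * (a * b) <= (a + b) ^ 2.
Proof. assert (0 <= (a - b) ^ 2) by apply pow2_ge_0; lra. Qed.

(* As for three points, now with the third divided difference; the points must be spaced for
   the error terms, which contain inverse products of distances, to stay small. *)
Lemma near_four (x h : R) (u1 u2 u3 u4 : Z) :
  regime x h -> near x h u1 -> near x h u2 -> near x h u3 -> near x h u4 ->
  (u1 < u2 < u3)%Z -> (u3 < u4)%Z ->
  spaced x u1 u2 -> spaced x u2 u3 -> spaced x u3 u4 ->
  h / 4 <= IZR u1 -> h ^ 2 * IZR u1 <= 0.004 * x ->
  12 * IZR u1 ^ 5 <= x * (IZR u4 - IZR u1) ^ 6.
Proof.
intros Hr N1 N2 N3 N4 Hu Hu' S1 S2 S3 Hz Hsm.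
(* The negation bounds the span from above, which keeps the inverse ratios near 1 and the error
   small. *)
apply Rnot_lt_le; intros Hcon.
assert (HUV : IZR u1 + 1 <= IZR u2) by (rewrite <- plus_IZR; apply IZR_le; lia).
assert (HVW : IZR u2 + 1 <= IZR u3) by (rewrite <- plus_IZR; apply IZR_le; lia).
assert (HWY : IZR u3 + 1 <= IZR u4) by (rewrite <- plus_IZR; apply IZR_le; lia).
destruct Hr as (Hh & Hh3 & Hx).
apply near_theta in N1 as (H1U & m1 & T1); apply near_theta in N2 as (H2U & m2 & T2).
apply near_theta in N3 as (H3U & m3 & T3); apply near_theta in N4 as (H4U & m4 & T4).
unfold spaced in *.
set (a := IZR u2 - IZR u1) in *; set (b := IZR u3 - IZR u2) in *.
set (c := IZR u4 - IZR u3) in *.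
assert (Ea : IZR (u2 - u1) = a) by apply minus_IZR.
assert (Eb : IZR (u3 - u2) = b) by apply minus_IZR.
assert (Ec : IZR (u4 - u3) = c) by apply minus_IZR.
(* The negated third divided difference of the cofactors, times the product of all six differences;
   with this sign the main term is positive. *)
set (I := ((u3 - u2) * (u4 - u3) * ((u3 - u2) + (u4 - u3)) * m1
  - (u4 - u3) * ((u2 - u1) + (u3 - u2)) * ((u2 - u1) + (u3 - u2) + (u4 - u3)) * m2
  + (u2 - u1) * ((u3 - u2) + (u4 - u3)) * ((u2 - u1) + (u3 - u2) + (u4 - u3)) * m3
  - (u2 - u1) * (u3 - u2) * ((u2 - u1) + (u3 - u2)) * m4)%Z).
assert (EI : IZR I = b * c * (b + c) * IZR m1 - c * (a + b) * (a + b + c) * IZR m2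
  + a * (b + c) * (a + b + c) * IZR m3 - a * b * (a + b) * IZR m4).
{ unfold I; rewrite minus_IZR, plus_IZR, minus_IZR, !mult_IZR, !plus_IZR, Ea, Eb, Ec; ring. }
assert (HI1 : 0 < IZR I -> 1 <= IZR I) by apply IZR_pos_ge1.
rewrite EI in HI1; clear EI I Ea Eb Ec.
assert (EL : IZR u4 - IZR u1 = a + b + c) by (unfold a, b, c; ring).
rewrite EL in Hcon.
set (L := a + b + c) in *.
assert (Ha : 1 <= a) by (unfold a; lra); assert (Hb : 1 <= b) by (unfold b; lra).
assert (Hc : 1 <= c) by (unfold c; lra).
set (U := IZR u1) in *; set (V := IZR u2) in *; set (W := IZR u3) in *; set (Y := IZR u4) in *.
assert (HL : 3 <= L) by (unfold L; lra).
assert (HLU : L <= U / 500).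
{ apply Rnot_lt_le; intros Hgt.
  assert ((U / 500) ^ 6 <= L ^ 6) by (apply pow_incr; lra).
  assert (HU5 : 0 < U ^ 5) by (apply pow_lt; lra).
  assert (x * (U / 500) ^ 6 <= x * L ^ 6) by (apply Rmult_le_compat_l; lra).
  replace (x * (U / 500) ^ 6) with (x * U / 15625000000000000 * U ^ 5) in * by field.
  assert (12 * U ^ 5 <= x * U / 15625000000000000 * U ^ 5); [|lra].
  apply Rmult_le_compat_r; [lra|]; nra. }
destruct (inv_ratio U V ltac:(lra) ltac:(lra) ltac:(lra)) as (r & Er & Hr1).
destruct (inv_ratio U W ltac:(lra) ltac:(lra) ltac:(lra)) as (s & Es & Hs1).
destruct (inv_ratio U Y ltac:(lra) ltac:(lra) ltac:(lra)) as (q & Eq & Hq1).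
assert (E : b * c * (b + c) * (/ U) ^ 2 - c * (a + b) * L * (/ V) ^ 2
  + a * (b + c) * L * (/ W) ^ 2 - a * b * (a + b) * (/ Y) ^ 2
  = a * b * c * (a + b) * (b + c) * L
    * (/ U * / V * / W * / Y * (/ U + / V + / W + / Y))).
{ unfold L, a, b, c; field; lra. }
rewrite <- !pow_inv in T1, T2, T3, T4.
rewrite Er, Es, Eq in *.
set (w := / U) in *.
assert (Hw : 0 < w) by (apply Rinv_0_lt_compat; lra).
assert (HwU : w * U = 1) by (apply Rinv_l; lra).
replace (w * (r * w) * (s * w) * (q * w) * (w + r * w + s * w + q * w))
  with (w ^ 5 * (r * s * q * (1 + r + s + q))) in E by ring.
assert (Hp : 3.95 <= r * s * q * (1 + r + s + q) <= 4).
{ assert (0.996 <= r * s <= 1) by nra; assert (0.99 <= r * s * q <= 1) by nra; nra. }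
set (p := r * s * q * (1 + r + s + q)) in *.
set (t1 := IZR m1 - x * w ^ 2) in *.
set (t2 := IZR m2 - x * (r * w) ^ 2) in *.
set (t3 := IZR m3 - x * (s * w) ^ 2) in *.
set (t4 := IZR m4 - x * (q * w) ^ 2) in *.
set (D := a * b * c * (a + b) * (b + c) * L) in *.
set (c1 := b * c * (b + c)) in *; set (c2 := c * (a + b) * L) in *.
set (c3 := a * (b + c) * L) in *; set (c4 := a * b * (a + b)) in *.
assert (Hc1 : 0 < c1) by (unfold c1; repeat apply Rmult_lt_0_compat; lra).
assert (Hc2 : 0 < c2) by (unfold c2; repeat apply Rmult_lt_0_compat; lra).
assert (Hc3 : 0 < c3) by (unfold c3; repeat apply Rmult_lt_0_compat; lra).
assert (Hc4 : 0 < c4) by (unfold c4; repeat apply Rmult_lt_0_compat; lra).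
assert (HD : 0 < D) by (unfold D; repeat apply Rmult_lt_0_compat; lra).
replace (c1 * IZR m1 - c2 * IZR m2 + c3 * IZR m3 - c4 * IZR m4)
  with (x * (D * (w ^ 5 * p)) + (c1 * t1 - c2 * t2 + c3 * t3 - c4 * t4)) in HI1
  by (rewrite <- E; unfold t1, t2, t3, t4; ring).
assert (Hsc : forall r, 0.998 <= r <= 1 -> h * (r * w) ^ 2 <= h * w ^ 2).
{ intros e He; apply Rmult_le_compat_l; [lra | apply pow_incr; split; [apply Rmult_le_pos; lra|]].
  rewrite <- (Rmult_1_l w) at 2; apply Rmult_le_compat_r; lra. }
assert (Hhw : 0 < h * w ^ 2) by (apply Rmult_lt_0_compat; [lra | apply pow_lt; lra]).
assert (Ht2 : t2 <= h * w ^ 2) by (apply Rle_trans with (2 := Hsc r Hr1); lra).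
assert (Ht3 : t3 <= h * w ^ 2) by (apply Rle_trans with (2 := Hsc s Hs1); lra).
assert (Ht4 : t4 <= h * w ^ 2) by (apply Rle_trans with (2 := Hsc q Hq1); lra).
assert (HUp4 : 0 < U ^ 4) by (apply pow_lt; lra).
assert (HUV4 : U ^ 4 <= V ^ 4) by (apply pow_incr; lra).
assert (HUW4 : U ^ 4 <= W ^ 4) by (apply pow_incr; lra).
assert (Hg : exists g, 0 < g /\ 1.3 * U ^ 4 <= x * g ^ 3 /\ g <= a /\ g <= b /\ g <= c).
{ exists (Rmin a (Rmin b c)).
  unfold Rmin; destruct (Rle_dec b c); destruct (Rle_dec a _); repeat split; lra. }
destruct Hg as (g & Hg0 & Hg & Hga & Hgb & Hgc).
assert (K2 : 2.6 * U ^ 4 * c2 <= x * D).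
{ replace (x * D) with (x * (a * b * (b + c)) * c2) by (unfold D, c2; ring).
  apply Rmult_le_compat_r; [lra|].
  assert (J1 := cube_mul_le (1.3 * U ^ 4) x g a b b ltac:(lra) Hg0 Hg Hga Hgb Hgb).
  assert (J2 := cube_mul_le (1.3 * U ^ 4) x g a b c ltac:(lra) Hg0 Hg Hga Hgb Hgc).
  lra. }
assert (K4 : 2.6 * U ^ 4 * c4 <= x * D).
{ replace (x * D) with (x * (c * (b + c) * (a + b + c)) * c4) by (unfold D, c4, L; ring).
  apply Rmult_le_compat_r; [lra|].
  assert (J1 := cube_mul_le (1.3 * U ^ 4) x g c b a ltac:(lra) Hg0 Hg Hgc Hgb Hga).
  assert (J2 := cube_mul_le (1.3 * U ^ 4) x g c b c ltac:(lra) Hg0 Hg Hgc Hgb Hgc).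
  assert (0 <= x * (c * b * b)) by (repeat apply Rmult_le_pos; lra).
  assert (0 <= x * (c * c * (a + b + c))) by (repeat apply Rmult_le_pos; lra).
  lra. }
assert (Hw5 : 0 < w ^ 5) by (apply pow_lt; lra).
(* Only [t2] and [t4] enter negatively. Spacing bounds [c2] and [c4] by x D / (2.6 U^4), and h <= 4
   U. *)
assert (Hpos : (c2 + c4) * (h * w ^ 2) < x * (D * (w ^ 5 * p))).
{ replace ((c2 + c4) * (h * w ^ 2)) with ((c2 + c4) * h * U ^ 3 * w ^ 5)
    by (replace ((c2 + c4) * h * U ^ 3 * w ^ 5)
          with ((c2 + c4) * (h * w ^ 2) * (w * U) ^ 3) by ring; rewrite HwU; ring).
  replace (x * (D * (w ^ 5 * p))) with (x * D * p * w ^ 5) by ring.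
  apply Rmult_lt_compat_r; auto.
  assert (0 < x * D) by (apply Rmult_lt_0_compat; lra).
  assert (x * D * 3.95 <= x * D * p) by (apply Rmult_le_compat_l; lra).
  assert (0 < U ^ 3 * (c2 + c4)) by (apply Rmult_lt_0_compat; [apply pow_lt|]; lra).
  assert (h * (U ^ 3 * (c2 + c4)) <= 4 * U * (U ^ 3 * (c2 + c4)))
    by (apply Rmult_le_compat_r; lra).
  lra. }
assert (Hpt : forall c t, 0 < c -> t <= h * w ^ 2 -> c * t <= c * (h * w ^ 2))
  by (intros; apply Rmult_le_compat_l; lra).
assert (HIpos : 0 < x * (D * (w ^ 5 * p)) + (c1 * t1 - c2 * t2 + c3 * t3 - c4 * t4)).
{ assert (0 < c1 * t1) by (apply Rmult_lt_0_compat; lra).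
  assert (0 < c3 * t3) by (apply Rmult_lt_0_compat; lra).
  assert (X2 := Hpt c2 t2 Hc2 Ht2); assert (X4 := Hpt c4 t4 Hc4 Ht4); lra. }
specialize (HI1 HIpos).
assert (Hc13 : c1 + c3 <= L ^ 3 / 2).
{ assert (4 * (b * c) <= (b + c) ^ 2) by apply four_mul_le.
  assert ((b + c) ^ 2 <= L ^ 2) by (apply pow_incr; unfold L; lra).
  assert (4 * (a * (b + c)) <= L ^ 2).
  { replace L with (a + (b + c)) by (unfold L; ring); apply four_mul_le. }
  assert (c1 <= L ^ 2 / 4 * L).
  { unfold c1; apply Rmult_le_compat; [apply Rmult_le_pos | | | unfold L]; lra. }
  assert (c3 <= L ^ 2 / 4 * L).
  { unfold c3; apply Rmult_le_compat; [apply Rmult_le_pos | | |]; lra. }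
  lra. }
(* [Hcon] controls L^6, so the bound is squared: (h L^3 / (2 U^2))^2 <= 3 h^2 U / x <= 0.012 <
   0.11^2. This is the source of 0.004. *)
assert (Herr : c1 * t1 - c2 * t2 + c3 * t3 - c4 * t4 <= 0.11).
{ assert (X1 := Hpt c1 t1 Hc1 (proj2 T1)); assert (X3 := Hpt c3 t3 Hc3 Ht3).
  assert (0 < c2 * t2) by (apply Rmult_lt_0_compat; lra).
  assert (0 < c4 * t4) by (apply Rmult_lt_0_compat; lra).
  assert (Hc13' : (c1 + c3) * (h * w ^ 2) <= L ^ 3 / 2 * (h * w ^ 2))
    by (apply Rmult_le_compat_r; lra).
  assert (L ^ 3 / 2 * (h * w ^ 2) <= 0.11); [|lra].
  apply Rsqr_incr_0_var; [unfold Rsqr | lra].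
  replace (L ^ 3 / 2 * (h * w ^ 2) * (L ^ 3 / 2 * (h * w ^ 2)))
    with (h ^ 2 * L ^ 6 / 4 * w ^ 4) by field.
  assert (HwU4 : w ^ 4 * U ^ 4 = 1) by (rewrite <- Rpow_mult_distr, HwU; ring).
  apply Rmult_le_reg_r with (x * U ^ 4); [apply Rmult_lt_0_compat; lra|].
  replace (h ^ 2 * L ^ 6 / 4 * w ^ 4 * (x * U ^ 4))
    with (h ^ 2 / 4 * (x * L ^ 6) * (w ^ 4 * U ^ 4)) by field.
  rewrite HwU4.
  assert (h ^ 2 / 4 * (x * L ^ 6) <= h ^ 2 / 4 * (12 * U ^ 5))
    by (apply Rmult_le_compat_l; [assert (0 <= h ^ 2) by apply pow2_ge_0 |]; lra).
  assert (h ^ 2 * U * (3 * U ^ 4) <= 0.004 * x * (3 * U ^ 4))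
    by (apply Rmult_le_compat_r; lra).
  assert (0 < x * U ^ 4) by (apply Rmult_lt_0_compat; lra).
  lra. }
assert (HDL : D <= 0.018 * L ^ 6) by (apply vandermonde4_le; lra).
assert (HwU5 : w ^ 5 * U ^ 5 = 1) by (rewrite <- Rpow_mult_distr, HwU; ring).
assert (HU5 : 0 < U ^ 5) by (apply pow_lt; lra).
assert (0.89 * U ^ 5 <= x * (D * (w ^ 5 * p)) * U ^ 5)
  by (apply Rmult_le_compat_r; lra).
replace (x * (D * (w ^ 5 * p)) * U ^ 5) with (x * D * p * (w ^ 5 * U ^ 5)) in * by ring.
rewrite HwU5 in *.
assert (0 < x * D) by (apply Rmult_lt_0_compat; lra).
assert (x * D * p <= x * D * 4) by (apply Rmult_le_compat_l; lra).
assert (x * D <= x * (0.018 * L ^ 6)) by (apply Rmult_le_compat_l; lra).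
(* After division by U^5 the main term is at least 0.89 but at most 4 * 0.018 * 12 = 0.864. *)
lra.
Qed.

(** * Counting by divided differences *)

Definition root (k : nat) (y : R) : R := Rpower y (/ INR k).

Lemma root_pos (k : nat) (y : R) : 0 < root k y.
Proof. apply exp_pos. Qed.

Lemma root_pow (k : nat) (y : R) : (0 < k)%nat -> 0 < y -> root k y ^ k = y.
Proof.
intros Hk Hy; unfold root.
rewrite <- Rpower_pow by apply exp_pos.
rewrite Rpower_mult, Rinv_l by (apply not_0_INR; lia).
now apply Rpower_1.
Qed.

Lemma pow_lt_mono (k : nat) (a b : R) : (0 < k)%nat -> 0 <= a < b -> a ^ k < b ^ k.
Proof.
intros Hk Hab; destruct k as [|k]; [lia|]; clear Hk.
induction k as [|k IH]; [simpl; lra|].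
change (a * a ^ S k < b * b ^ S k).
apply Rmult_le_0_lt_compat; try lra; apply pow_le; lra.
Qed.

Lemma pow_le_cancel (k : nat) (a b : R) : (0 < k)%nat -> 0 <= b -> a ^ k <= b ^ k -> a <= b.
Proof.
intros Hk Hb H; apply Rnot_lt_le; intros Hba.
assert (b ^ k < a ^ k) by (apply pow_lt_mono; auto; lra); lra.
Qed.

Lemma root_le (k : nat) (a b : R) : (0 < k)%nat -> 0 < a <= b -> root k a <= root k b.
Proof.
intros Hk Hab; apply (pow_le_cancel k); auto; [left; apply root_pos|].
rewrite !root_pow; auto; lra.
Qed.

(** The potential - x / (0.98 u^2) grows by 1 at each point by [near_two], the error h / u^2 being
    at most 0.02. *)
Lemma count_two (x h z : R) :
  0 < x -> 0 < h -> 0 < z -> h <= 0.02 * z ^ 2 -> h ^ 2 <= x -> h <= x ->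
  at_most (fun u => near x h u /\ z < IZR u) (1 + x / z ^ 2 / 0.98).
Proof.
intros Hx Hh Hz Hhz Hhx Hhx'.
assert (HhU : forall u, near x h u -> h * IZR u <= 2 * x).
{ intros u Nu; assert (HU2 := near_sq_le x h u Hx Nu).
  apply Rsqr_incr_0_var; [unfold Rsqr | lra].
  assert (h ^ 2 * IZR u ^ 2 <= x * (x + h)) by (apply Rmult_le_compat; nra).
  nra. }
replace (1 + x / z ^ 2 / 0.98) with (1 + (0 - - (x / z ^ 2 / 0.98))) by ring.
assert (Hpos : 0 < x / z ^ 2 / 0.98).
{ apply Rdiv_lt_0_compat; [apply Rdiv_lt_0_compat; [lra | apply pow_lt; lra] | lra]. }
apply at_most_potential1 with (phi := fun u => - (x / IZR u ^ 2 / 0.98)); [lra | |].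
- intros u [Nu Hu]; apply near_theta in Nu as [HU _].
  assert (HUi : 0 < / IZR u ^ 2 <= / z ^ 2).
  { split; [apply Rinv_0_lt_compat; nra | apply Rinv_le_contravar; nra]. }
  unfold Rdiv; split; nra.
- intros u v [Nu Hu] [Nv Hv] Huv.
  assert (K := near_two x h u v Hx Hh Nu Nv Huv (HhU u Nu)).
  apply near_theta in Nu as [HU _].
  assert (h * / IZR u ^ 2 <= 0.02).
  { apply Rmult_le_reg_r with (IZR u ^ 2); [nra|].
    rewrite Rmult_assoc, Rinv_l by nra; nra. }
  unfold Rdiv; lra.
Qed.

(* Hence u |-> - (x/u)^(1/3) / 0.35 increases by at least 1 along three near points. *)
Lemma spaced_root3 (x U V : R) :
  0 < U -> U <= V -> 8000 * U <= x -> 1.3 * U ^ 4 <= x * (V - U) ^ 3 ->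
  root 3 (x / V) + 0.35 <= root 3 (x / U).
Proof.
intros HU HUV HUx Hsp.
assert (Hp3 : root 3 (x / U) ^ 3 = x / U) by (apply root_pow; [lia | apply Rdiv_lt_0_compat; lra]).
assert (Hq3 : root 3 (x / V) ^ 3 = x / V) by (apply root_pow; [lia | apply Rdiv_lt_0_compat; lra]).
assert (Hp := root_pos 3 (x / U)); assert (Hq := root_pos 3 (x / V)).
set (p := root 3 (x / U)) in *; set (q := root 3 (x / V)) in *.
assert (HpU : p ^ 3 * U = x) by (rewrite Hp3; field; lra).
assert (HqV : q ^ 3 * V = x) by (rewrite Hq3; field; lra).
assert (Hp20 : 20 <= p).
{ apply (pow_le_cancel 3); [lia | lra |].
  apply Rmult_le_reg_r with U; lra. }
(* The cube root of the spacing inequality, as 1.091^3 < 1.3. *)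
assert (Hd : 1.091 * U <= p * (V - U)).
{ apply (pow_le_cancel 3); [lia | apply Rmult_le_pos; lra |].
  rewrite !Rpow_mult_distr.
  assert (HU3 : 0 < U ^ 3) by (apply pow_lt; lra).
  apply Rmult_le_reg_r with U; [lra|].
  replace (p ^ 3 * (V - U) ^ 3 * U) with (p ^ 3 * U * (V - U) ^ 3) by ring.
  rewrite HpU; assert (0 < U ^ 4) by (apply pow_lt; lra); lra. }
assert (Hpq : (p + 1.091) * q ^ 3 <= p ^ 4).
{ apply Rmult_le_reg_r with (U * V); [apply Rmult_lt_0_compat; lra|].
  replace ((p + 1.091) * q ^ 3 * (U * V)) with ((p + 1.091) * U * (q ^ 3 * V)) by ring.
  replace (p ^ 4 * (U * V)) with (p * V * (p ^ 3 * U)) by ring.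
  rewrite HpU, HqV; apply Rmult_le_compat_r; lra. }
(* For p >= 20, (p + 1.091) (p - 0.35)^3 exceeds p^4: the cubic coefficient 1.091 - 3 * 0.35 = 0.041
   outweighs the negative quadratic term. *)
apply Rnot_lt_le; intros Hlt.
assert (Hq' : (p - 0.35) ^ 3 <= q ^ 3) by (apply pow_incr; lra).
assert ((p + 1.091) * (p - 0.35) ^ 3 <= (p + 1.091) * q ^ 3)
  by (apply Rmult_le_compat_l; lra).
nra.
Qed.

Lemma count_three (x h z : R) :
  regime x h -> h / 4 <= z ->
  at_most (fun u => near x h u /\ z < IZR u) (2 * (1 + 2.86 * root 3 (x / z))).
Proof.
intros Hr Hz.
assert (Hz0 : 0 < z) by (destruct Hr; lra).
assert (Hx0 : 0 < x) by (destruct Hr; lra).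
replace (2 * (1 + 2.86 * root 3 (x / z)))
  with (2 * (1 + (0 - - (2.86 * root 3 (x / z))))) by ring.
assert (Hp := root_pos 3 (x / z)).
apply at_most_potential2 with (phi := fun u => - (2.86 * root 3 (x / IZR u))); [lra | |].
- intros u [Nu Hu].
  assert (Hq := root_pos 3 (x / IZR u)).
  assert (root 3 (x / IZR u) <= root 3 (x / z)); [|lra].
  apply root_le; [lia|]; split; [apply Rdiv_lt_0_compat; lra|].
  apply Rmult_le_compat_l; [lra | apply Rinv_le_contravar; lra].
- intros u v w [Nu Hu] [Nv Hv] [Nw Hw] Huvw.
  assert (Hs := near_three x h u v w Hr Nu Nv Nw Huvw ltac:(lra)).
  destruct (regime_near x h u Hr Nu ltac:(lra)) as (_ & _ & C1).
  assert (IZR u < IZR w) by (apply IZR_lt; lia).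
  assert (root 3 (x / IZR w) + 0.35 <= root 3 (x / IZR u)); [|lra].
  apply spaced_root3; auto; lra.
Qed.

(** With U = w s^6 the span is at least 1.5 s^5, as 1.5^6 < 12. The derivative of w s^6 is 6 w s^5,
    so s grows by nearly 0.25 / w; 0.24 absorbs the higher order terms. *)
Lemma span_root6 (w U Y : R) :
  2400 <= w -> 5000 <= U -> U <= Y -> 12 * U ^ 5 <= w ^ 5 * (Y - U) ^ 6 ->
  w / 0.24 * root 6 (U / w) + 1 <= w / 0.24 * root 6 (Y / w).
Proof.
intros Hw HU HUY Hsp.
assert (Hp3 : root 6 (U / w) ^ 6 = U / w) by (apply root_pow; [lia | apply Rdiv_lt_0_compat; lra]).
assert (Hq3 : root 6 (Y / w) ^ 6 = Y / w) by (apply root_pow; [lia | apply Rdiv_lt_0_compat; lra]).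
assert (Hp := root_pos 6 (U / w)); assert (Hq := root_pos 6 (Y / w)).
set (s := root 6 (U / w)) in *; set (r := root 6 (Y / w)) in *.
assert (HpU : U = w * s ^ 6) by (rewrite Hp3; field; lra).
assert (HqY : Y = w * r ^ 6) by (rewrite Hq3; field; lra).
assert (Hws : 2400 <= w * s).
{ destruct (Rle_lt_dec 1 s) as [Hs | Hs]; [nra|].
  assert (s ^ 5 <= 1) by (rewrite <- (pow1 5); apply pow_incr; lra).
  assert (w * s * s ^ 5 <= w * s * 1) by (apply Rmult_le_compat_l; [nra | lra]).
  lra. }
assert (Hd : 1.5 * s ^ 5 <= Y - U).
{ apply (pow_le_cancel 6); [lia | lra |].
  assert (Hw5 : 0 < w ^ 5) by (apply pow_lt; lra).
  apply Rmult_le_reg_l with (w ^ 5); [lra|].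
  assert (E : w ^ 5 * (1.5 * s ^ 5) ^ 6 = 1.5 ^ 6 * U ^ 5)
    by (rewrite HpU at 1; ring).
  rewrite E; assert (0 < U ^ 5) by (apply pow_lt; lra); lra. }
assert (Hrs : s + 0.24 / w <= r).
{ apply (pow_le_cancel 6); [lia | lra |].
  (* Raising s by the factor 1 + e raises w s^6 by at most 6.25 e w s^6 = 1.5 s^5, which [Hd]
     provides. *)
  set (e := 0.24 / (w * s)).
  assert (He : 0 < e <= 0.0001).
  { split; [apply Rdiv_lt_0_compat; lra|]; unfold e.
    apply Rmult_le_reg_r with (w * s); [lra|].
    unfold Rdiv; rewrite Rmult_assoc, Rinv_l by lra; lra. }
  replace (s + 0.24 / w) with (s * (1 + e)) by (unfold e; field; lra).
  rewrite Rpow_mult_distr.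
  apply Rle_trans with (s ^ 6 * (1 + 6.25 * e)).
  - apply Rmult_le_compat_l; [apply pow_le; lra|].
    replace ((1 + e) ^ 6)
      with (1 + e * (6 + e * (15 + e * (20 + e * (15 + e * (6 + e)))))) by ring.
    assert (0 <= e * (15 + e * (20 + e * (15 + e * (6 + e)))) <= 0.25); [|nra].
    assert (0 <= e * (6 + e) <= 1) by nra.
    assert (0 <= e * (15 + e * (6 + e)) <= 1) by nra.
    assert (0 <= e * (20 + e * (15 + e * (6 + e))) <= 1) by nra.
    nra.
  - apply Rmult_le_reg_l with w; [lra|].
    assert (Hes : e * (w * s) = 0.24) by (unfold e; field; lra).
    replace (w * (s ^ 6 * (1 + 6.25 * e))) with (w * s ^ 6 + 6.25 * (e * (w * s)) * s ^ 5)
      by ring.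
    rewrite Hes; lra. }
assert (w * (s + 0.24 / w) <= w * r) by (apply Rmult_le_compat_l; lra).
replace (w * (s + 0.24 / w)) with (w * s + 0.24) in * by (field; lra).
lra.
Qed.

(** Passing to every other point (factor 2) makes all pairs spaced; then four consecutive points,
    that is three steps (factor 3), raise the potential by 1. *)
Lemma count_four (x h w z T : R) :
  regime x h -> 0 < w -> w ^ 5 = x -> h / 4 <= z -> 0 < T -> h ^ 2 * T <= 0.004 * x ->
  at_most (fun u => near x h u /\ z < IZR u <= T) (2 * (3 * (1 + w / 0.24 * root 6 (T / w)))).
Proof.
intros Hr Hw Hwx Hz HT HhT.
assert (Hw' : 2400 <= w).
{ apply (pow_le_cancel 5); [lia | lra |]; destruct Hr; lra. }
assert (Hh : 20000 <= h) by (destruct Hr; lra).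
apply at_most_alternate with (Rel := spaced x).
{ intros u v y [Nu Hu] [Nv Hv] [Ny Hy] Huvy.
  apply near_three with h v; auto; lra. }
intros Q HQ HQs.
replace (w / 0.24 * root 6 (T / w)) with (w / 0.24 * root 6 (T / w) - 0) by ring.
apply at_most_potential3 with (phi := fun u => w / 0.24 * root 6 (IZR u / w)).
- apply Rmult_le_pos; [lra | left; apply root_pos].
- intros u Qu; destruct (HQ u Qu) as [Nu Hu]; split.
  + apply Rmult_le_pos; [lra | left; apply root_pos].
  + apply Rmult_le_compat_l; [lra|]; apply root_le; [lia|]; split.
    * apply Rdiv_lt_0_compat; lra.
    * apply Rmult_le_compat_r; [left; apply Rinv_0_lt_compat|]; lra.
- intros u v y a Qu Qv Qy Qa Huvy Hya.
  destruct (HQ u Qu) as [Nu Hu]; destruct (HQ v Qv) as [Nv Hv].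
  destruct (HQ y Qy) as [Ny Hy]; destruct (HQ a Qa) as [Na Ha].
  assert (IZR u < IZR a) by (apply IZR_lt; lia).
  apply span_root6; try lra.
  rewrite Hwx; apply near_four with h v y; auto; try (apply HQs; auto; lia); try lra.
  apply Rle_trans with (h ^ 2 * T); [apply Rmult_le_compat_l; [apply pow2_ge_0|]; lra | lra].
Qed.

(** * Pairs at a fixed distance *)

(** An explicit function instead of an existential witness; for near u with h < u^2 it is the
    multiplier m of u^2. *)
Definition cofactor (x : R) (u : Z) : Z := up (x * / IZR u ^ 2).

Lemma near_cofactor (x h : R) (u : Z) :
  near x h u -> h < IZR u ^ 2 ->
  1 <= IZR u /\ 0 < IZR (cofactor x u) - x * / IZR u ^ 2 <= h * / IZR u ^ 2.
Proof.
intros N Hh; apply near_theta in N as (HU & m & Hm); split; auto.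
assert (Hs : h * / IZR u ^ 2 < 1).
{ apply Rmult_lt_reg_r with (IZR u ^ 2); [nra|].
  rewrite Rmult_assoc, Rinv_l by nra; lra. }
replace (cofactor x u) with m; auto.
apply tech_up; lra.
Qed.

(* The identity (2u + 3a) u^2 - (2u - a) (u + a)^2 = a^3 makes this combination of
   x/u^2 and x/(u + a)^2 as small as x a^3 / (u^2 (u + a)^2). *)
Definition det (x : R) (a u : Z) : Z :=
  ((2 * u + 3 * a) * cofactor x (u + a) - (2 * u - a) * cofactor x u)%Z.

Definition det_main (x A U : R) : R := x * A ^ 3 / (U ^ 2 * (U + A) ^ 2).

(** Both rounding errors contribute between 0 and 2 h / u, the second by (2u + 3a) u <= 2 (u + a)^2,
    and they enter with opposite signs. *)
Lemma det_approx (x h : R) (a u : Z) :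
  0 < h -> near x h u -> near x h (u + a) -> (0 < a)%Z -> IZR a <= IZR u ->
  h < IZR u ^ 2 ->
  Rabs (IZR (det x a u) - det_main x (IZR a) (IZR u)) <= 2 * h / IZR u.
Proof.
intros Hh N1 N2 Ha Hau Hhu.
assert (HA : 1 <= IZR a) by (apply IZR_le; lia).
apply near_cofactor in N1 as [HU T1]; auto.
apply near_cofactor in N2 as [_ T2]; [| rewrite plus_IZR; nra].
unfold det; rewrite minus_IZR, !mult_IZR, plus_IZR, minus_IZR, !mult_IZR.
rewrite plus_IZR in T2.
set (U := IZR u) in *; set (A := IZR a) in *.
set (m1 := IZR (cofactor x u)) in *; set (m2 := IZR (cofactor x (u + a))) in *.
assert (HiU : 0 < / U ^ 2) by (apply Rinv_0_lt_compat; nra).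
replace ((2 * U + 3 * A) * m2 - (2 * U - A) * m1 - det_main x A U)
  with ((2 * U + 3 * A) * (m2 - x * / (U + A) ^ 2) - (2 * U - A) * (m1 - x * / U ^ 2))
  by (unfold det_main; field; lra).
assert (E1 : 0 <= (2 * U - A) * (m1 - x * / U ^ 2) <= 2 * h / U).
{ split; [apply Rmult_le_pos; lra|].
  apply Rle_trans with (2 * U * (h * / U ^ 2)); [apply Rmult_le_compat; lra|].
  right; field; lra. }
assert (E2 : 0 <= (2 * U + 3 * A) * (m2 - x * / (U + A) ^ 2) <= 2 * h / U).
{ split; [apply Rmult_le_pos; lra|].
  apply Rle_trans with ((2 * U + 3 * A) * (h * / (U + A) ^ 2));
    [apply Rmult_le_compat_l; lra|].
  apply Rmult_le_reg_r with (U * (U + A) ^ 2); [apply Rmult_lt_0_compat; nra|].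
  replace ((2 * U + 3 * A) * (h * / (U + A) ^ 2) * (U * (U + A) ^ 2))
    with (h * ((2 * U + 3 * A) * U)) by (field; lra).
  replace (2 * h / U * (U * (U + A) ^ 2)) with (h * (2 * (U + A) ^ 2)) by (field; lra).
  apply Rmult_le_compat_l; nra. }
apply Rabs_le; lra.
Qed.

Lemma det_main_bounds (x A U : R) :
  0 < x -> 0 < A -> 0 < U -> A <= U / 8000 ->
  0.999 * (x * A ^ 3) <= det_main x A U * U ^ 4 <= x * A ^ 3.
Proof.
intros Hx HA HU HAU; unfold det_main.
assert (HxA : 0 < x * A ^ 3) by (apply Rmult_lt_0_compat; [|apply pow_lt]; lra).
replace (x * A ^ 3 / (U ^ 2 * (U + A) ^ 2) * U ^ 4) with (x * A ^ 3 * (U / (U + A)) ^ 2)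
  by (field; lra).
assert (H : 0.9998 <= U / (U + A) <= 1).
{ split; apply Rmult_le_reg_r with (U + A); try lra;
    unfold Rdiv; rewrite Rmult_assoc, Rinv_l by lra; lra. }
assert (0.999 <= (U / (U + A)) ^ 2 <= 1) by nra.
split; [rewrite Rmult_comm | rewrite <- (Rmult_1_r (x * A ^ 3)) at 2];
  apply Rmult_le_compat_l; lra.
Qed.

(** [det_main] behaves like U^(-4), so its relative decrease is about 4 (V - U) / U; 3.98 allows for
    the shift A. *)
Lemma det_main_decay (x A U V : R) :
  0 < x -> 0 < A -> 0 < U < V -> A <= U / 8000 ->
  det_main x A V * (1 + 3.98 * (V - U) / U) <= det_main x A U.
Proof.
intros Hx HA HU HAU; unfold det_main.
assert (HxA : 0 < x * A ^ 3) by (apply Rmult_lt_0_compat; [|apply pow_lt]; lra).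
set (k := V * (V + A) / (U * (U + A))).
replace (x * A ^ 3 / (U ^ 2 * (U + A) ^ 2))
  with (x * A ^ 3 / (V ^ 2 * (V + A) ^ 2) * k ^ 2) by (unfold k; field; lra).
apply Rmult_le_compat_l.
{ left; apply Rdiv_lt_0_compat; auto; apply Rmult_lt_0_compat; nra. }
assert (Hk : 1 + 1.99 * ((V - U) / U) <= k).
{ unfold k; apply Rmult_le_reg_r with (U * (U + A)); [nra|].
  replace ((1 + 1.99 * ((V - U) / U)) * (U * (U + A)))
    with ((U + 1.99 * (V - U)) * (U + A)) by (field; lra).
  replace (V * (V + A) / (U * (U + A)) * (U * (U + A))) with (V * (V + A))
    by (field; lra).
  nra. }
assert (0 < (V - U) / U) by (apply Rdiv_lt_0_compat; lra).
replace (3.98 * (V - U) / U) with (2 * (1.99 * ((V - U) / U))) by (unfold Rdiv; lra).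
nra.
Qed.

Lemma four_product_bounds (e r1 r2 r3 r4 : R) :
  0 < e <= 1 / 8000 ->
  1 - e <= r1 <= 1 - 0.997 * e -> 1 - e <= r2 <= 1 - 0.997 * e ->
  1 - e <= r3 <= 1 - 0.997 * e -> 1 - e <= r4 <= 1 - 0.997 * e ->
  1 - 4 * e <= r1 * r2 * r3 * r4 <= 1 - 3.98 * e.
Proof.
intros He H1 H2 H3 H4; split.
- assert (1 - 2 * e <= r1 * r2) by nra. assert (1 - 2 * e <= r3 * r4) by nra.
  assert (r1 * r2 <= 1) by nra. assert (r3 * r4 <= 1) by nra. nra.
- assert (r1 * r2 <= 1 - 1.993 * e) by nra. assert (r3 * r4 <= 1 - 1.993 * e) by nra.
  assert (0 <= r1 * r2) by nra. assert (0 <= r3 * r4) by nra.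
  apply Rle_trans with ((1 - 1.993 * e) * (1 - 1.993 * e)); [|nra].
  rewrite Rmult_assoc; apply Rmult_le_compat; lra.
Qed.

Lemma inv_shift_ratio (U W A : R) :
  0 < U -> U <= W -> W - U <= U / 500 -> 0 < A -> A <= U / 8000 ->
  exists r, / (W + A) = r * / W /\ 1 - A / U <= r <= 1 - 0.997 * (A / U).
Proof.
intros HU HUW HW HA HAU; exists (W / (W + A)); split; [field; lra|].
split; apply Rmult_le_reg_r with (U * (W + A)); try nra.
- replace ((1 - A / U) * (U * (W + A))) with ((U - A) * (W + A)) by (field; lra).
  replace (W / (W + A) * (U * (W + A))) with (W * U) by (field; lra). nra.
- replace ((1 - 0.997 * (A / U)) * (U * (W + A))) with ((U - 0.997 * A) * (W + A))
    by (field; lra).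
  replace (W / (W + A) * (U * (W + A))) with (W * U) by (field; lra). nra.
Qed.

Lemma second_difference (U V W : R) :
  U <> 0 -> V <> 0 -> W <> 0 ->
  (W - V) * (/ U) ^ 2 - (W - U) * (/ V) ^ 2 + (V - U) * (/ W) ^ 2
  = (V - U) * (W - V) * (W - U) * (/ U * / V * / W * (/ U + / V + / W)).
Proof. intros; field; auto. Qed.

(** The second divided difference of 1/u^2 is close to 3 / U^4, so a shift of the points by A lowers
    it by about 12 A / U^5. *)
Lemma shift_difference_bounds (U V W A : R) :
  0 < U -> U <= V -> V <= W -> W - U <= U / 500 -> 0 < A -> A <= U / 8000 ->
  11.8 * A * (/ U) ^ 5
  <= / U * / V * / W * (/ U + / V + / W)
     - / (U + A) * / (V + A) * / (W + A) * (/ (U + A) + / (V + A) + / (W + A))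
  <= 12 * A * (/ U) ^ 5.
Proof.
intros HU HUV HVW HWU HA HAU.
destruct (inv_ratio U V ltac:(lra) ltac:(lra) ltac:(lra)) as (r & Er & Hr).
destruct (inv_ratio U W ltac:(lra) ltac:(lra) ltac:(lra)) as (s & Es & Hs).
destruct (inv_shift_ratio U U A ltac:(lra) ltac:(lra) ltac:(lra) ltac:(lra) ltac:(lra))
  as (r1 & E1 & H1).
destruct (inv_shift_ratio U V A ltac:(lra) ltac:(lra) ltac:(lra) ltac:(lra) ltac:(lra))
  as (r2 & E2 & H2).
destruct (inv_shift_ratio U W A ltac:(lra) ltac:(lra) ltac:(lra) ltac:(lra) ltac:(lra))
  as (r3 & E3 & H3).
rewrite E1, E2, E3, Er, Es.
assert (He : 0 < A / U <= 1 / 8000).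
{ split; [apply Rdiv_lt_0_compat; lra|].
  apply Rmult_le_reg_r with U; [lra|]; unfold Rdiv at 1; rewrite Rmult_assoc, Rinv_l by lra; lra. }
set (e := A / U) in *.
assert (P1 := four_product_bounds e r1 r2 r3 r1 He H1 H2 H3 H1).
assert (P2 := four_product_bounds e r1 r2 r3 r2 He H1 H2 H3 H2).
assert (P3 := four_product_bounds e r1 r2 r3 r3 He H1 H2 H3 H3).
set (w := / U) in *.
assert (Hw : 0 < w) by (apply Rinv_0_lt_compat; lra).
assert (Hw4 : 0 < w ^ 4) by (apply pow_lt; lra).
replace (12 * A * w ^ 5) with (w ^ 4 * (12 * e)) by (unfold e, w; field; lra).
replace (11.8 * A * w ^ 5) with (w ^ 4 * (11.8 * e)) by (unfold e, Rdiv; fold w; ring).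
replace (w * (r * w) * (s * w) * (w + r * w + s * w)
  - r1 * w * (r2 * (r * w)) * (r3 * (s * w)) * (r1 * w + r2 * (r * w) + r3 * (s * w)))
  with (w ^ 4 * (r * s * ((1 - r1 * r2 * r3 * r1) + r * (1 - r1 * r2 * r3 * r2)
    + s * (1 - r1 * r2 * r3 * r3)))) by ring.
set (q1 := 1 - r1 * r2 * r3 * r1) in *; set (q2 := 1 - r1 * r2 * r3 * r2) in *.
set (q3 := 1 - r1 * r2 * r3 * r3) in *.
assert (Q1 : 3.98 * e <= q1 <= 4 * e) by (unfold q1; lra).
assert (Q2 : 3.98 * e <= q2 <= 4 * e) by (unfold q2; lra).
assert (Q3 : 3.98 * e <= q3 <= 4 * e) by (unfold q3; lra).
clearbody q1 q2 q3 e w; clear - Hr Hs He Q1 Q2 Q3 Hw4.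
assert (Hrq : 0.998 * (3.98 * e) <= r * q2 <= 4 * e).
{ split; [apply Rmult_le_compat; lra|].
  rewrite <- (Rmult_1_l (4 * e)); apply Rmult_le_compat; lra. }
assert (Hsq : 0.998 * (3.98 * e) <= s * q3 <= 4 * e).
{ split; [apply Rmult_le_compat; lra|].
  rewrite <- (Rmult_1_l (4 * e)); apply Rmult_le_compat; lra. }
assert (Hrs : 0.996 <= r * s <= 1) by nra.
split; apply Rmult_le_compat_l; try lra.
- apply Rle_trans with (0.996 * (3.98 * e + 0.998 * (3.98 * e) + 0.998 * (3.98 * e)));
    [lra | apply Rmult_le_compat; lra].
- rewrite <- (Rmult_1_l (12 * e)); apply Rmult_le_compat; lra.
Qed.

(* The second divided difference of u |-> m(u) - m(u + a), where m(u) is the cofactor of u. *)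
Lemma near_pairs_three (x h : R) (a u1 u2 u3 : Z) :
  regime x h -> (0 < a)%Z -> (u1 < u2 < u3)%Z ->
  near x h u1 -> near x h u2 -> near x h u3 ->
  near x h (u1 + a) -> near x h (u2 + a) -> near x h (u3 + a) ->
  spaced x u1 u2 -> spaced x u2 u3 -> spaced x u1 (u1 + a) ->
  600 * h <= IZR u1 -> IZR u3 - IZR u1 <= IZR u1 / 500 -> IZR a <= IZR u1 / 8000 ->
  0.32 * IZR u1 ^ 5 <= x * IZR a * (IZR u3 - IZR u1) ^ 3.
Proof.
intros Hr Ha Hu N1 N2 N3 M1 M2 M3 S1 S2 S3 Hz Hcl HaU.
assert (HA : 1 <= IZR a) by (apply IZR_le; lia).
assert (HUV : IZR u1 + 1 <= IZR u2) by (rewrite <- plus_IZR; apply IZR_le; lia).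
assert (HVW : IZR u2 + 1 <= IZR u3) by (rewrite <- plus_IZR; apply IZR_le; lia).
destruct Hr as (Hh & Hh3 & Hx).
apply near_cofactor in N1 as [_ T1]; [|nra]; apply near_cofactor in N2 as [_ T2]; [|nra].
apply near_cofactor in N3 as [_ T3]; [|nra].
apply near_cofactor in M1 as [_ R1]; [|rewrite plus_IZR; nra].
apply near_cofactor in M2 as [_ R2]; [|rewrite plus_IZR; nra].
apply near_cofactor in M3 as [_ R3]; [|rewrite plus_IZR; nra].
set (n1 := (cofactor x u1 - cofactor x (u1 + a))%Z).
set (n2 := (cofactor x u2 - cofactor x (u2 + a))%Z).
set (n3 := (cofactor x u3 - cofactor x (u3 + a))%Z).
set (I := ((u3 - u2) * n1 - (u3 - u1) * n2 + (u2 - u1) * n3)%Z).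
assert (EI : IZR I = (IZR u3 - IZR u2) * (IZR (cofactor x u1) - IZR (cofactor x (u1 + a)))
  - (IZR u3 - IZR u1) * (IZR (cofactor x u2) - IZR (cofactor x (u2 + a)))
  + (IZR u2 - IZR u1) * (IZR (cofactor x u3) - IZR (cofactor x (u3 + a))))
  by (unfold I, n1, n2, n3; rewrite plus_IZR, minus_IZR, !mult_IZR, !minus_IZR; ring).
assert (HI1 : 0 < IZR I -> 1 <= IZR I) by apply IZR_pos_ge1.
rewrite EI in HI1; clear EI I n1 n2 n3.
unfold spaced in *; rewrite plus_IZR in S3.
rewrite plus_IZR in R1, R2, R3.
set (U := IZR u1) in *; set (V := IZR u2) in *; set (W := IZR u3) in *.
set (A := IZR a) in *.
rewrite <- !pow_inv in T1, T2, T3, R1, R2, R3.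
assert (E := second_difference U V W ltac:(lra) ltac:(lra) ltac:(lra)).
assert (E' := second_difference (U + A) (V + A) (W + A) ltac:(lra) ltac:(lra) ltac:(lra)).
replace (W + A - (V + A)) with (W - V) in E' by ring.
replace (W + A - (U + A)) with (W - U) in E' by ring.
replace (V + A - (U + A)) with (V - U) in E' by ring.
assert (HF := shift_difference_bounds U V W A ltac:(lra) ltac:(lra) ltac:(lra) Hcl
  ltac:(lra) HaU).
set (P := / U * / V * / W * (/ U + / V + / W)) in *.
set (P' := / (U + A) * / (V + A) * / (W + A) * (/ (U + A) + / (V + A) + / (W + A))) in *.
assert (Hinv : forall y, U <= y -> h * (/ y) ^ 2 <= h * (/ U) ^ 2).
{ intros y Hy; apply Rmult_le_compat_l; [lra|].
  apply pow_incr; split; [left; apply Rinv_0_lt_compat | apply Rinv_le_contravar]; lra. }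
assert (HV2 := Hinv V ltac:(lra)); assert (HW2 := Hinv W ltac:(lra)).
assert (HU3 := Hinv (U + A) ltac:(lra)); assert (HV3 := Hinv (V + A) ltac:(lra)).
assert (HW3 := Hinv (W + A) ltac:(lra)).
(* Each [t] is a difference of two errors in (0, d], so its sign is unknown and only its absolute
   value is bounded, by d. *)
set (t1 := IZR (cofactor x u1) - x * (/ U) ^ 2 - (IZR (cofactor x (u1 + a)) - x * (/ (U + A)) ^ 2)).
set (t2 := IZR (cofactor x u2) - x * (/ V) ^ 2 - (IZR (cofactor x (u2 + a)) - x * (/ (V + A)) ^ 2)).
set (t3 := IZR (cofactor x u3) - x * (/ W) ^ 2 - (IZR (cofactor x (u3 + a)) - x * (/ (W + A)) ^ 2)).
set (d := h * (/ U) ^ 2) in *.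
assert (B1 : - d <= t1 <= d) by (unfold t1; lra).
assert (B2 : - d <= t2 <= d) by (unfold t2; lra).
assert (B3 : - d <= t3 <= d) by (unfold t3; lra).
replace ((W - V) * (IZR (cofactor x u1) - IZR (cofactor x (u1 + a)))
  - (W - U) * (IZR (cofactor x u2) - IZR (cofactor x (u2 + a)))
  + (V - U) * (IZR (cofactor x u3) - IZR (cofactor x (u3 + a))))
  with (x * ((V - U) * (W - V) * (W - U) * (P - P'))
    + ((W - V) * t1 - (W - U) * t2 + (V - U) * t3)) in HI1
  by (rewrite Rmult_minus_distr_l, <- E, <- E'; unfold t1, t2, t3; ring).
clearbody t1 t2 t3 P P'; clear E E' T1 T2 T3 R1 R2 R3 HV2 HW2 HU3 HV3 HW3 Hinv.
set (b := V - U) in *; set (c := W - V) in *.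
assert (Ebc : W - U = b + c) by (unfold b, c; ring); rewrite Ebc in *.
assert (Hb : 1 <= b) by (unfold b; lra); assert (Hc : 1 <= c) by (unfold c; lra).
assert (Herr : - (2 * (b + c) * d) <= c * t1 - (b + c) * t2 + b * t3 <= 2 * (b + c) * d).
{ assert (forall k t, 0 <= k -> - d <= t <= d -> - (k * d) <= k * t <= k * d).
  { intros k t Hk Ht; split; [rewrite Ropp_mult_distr_r|]; apply Rmult_le_compat_l; lra. }
  assert (X1 := H c t1 ltac:(lra) B1); assert (X2 := H (b + c) t2 ltac:(lra) B2).
  assert (X3 := H b t3 ltac:(lra) B3); lra. }
set (w := / U) in *.
assert (Hw : 0 < w) by (apply Rinv_0_lt_compat; lra).
assert (HwU : w * U = 1) by (apply Rinv_l; lra).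
set (err := c * t1 - (b + c) * t2 + b * t3) in *; clearbody err; clear B1 B2 B3 t1 t2 t3.
assert (HUp : 0 < U ^ 4) by (apply pow_lt; lra).
assert (HUV4 : U ^ 4 <= V ^ 4) by (apply pow_incr; lra).
assert (Hg : exists g, 0 < g /\ 1.3 * U ^ 4 <= x * g ^ 3 /\ g <= b /\ g <= c /\ g <= A).
{ exists (Rmin b (Rmin c A)).
  replace (U + A - U) with A in S3 by ring.
  unfold Rmin; destruct (Rle_dec c A); destruct (Rle_dec b _); repeat split; lra. }
destruct Hg as (g & Hg0 & Hg & Hgb & Hgc & HgA).
assert (HbcA := cube_mul_le (1.3 * U ^ 4) x g b c A ltac:(lra) Hg0 Hg Hgb Hgc HgA).
assert (Hw5 : 0 < w ^ 5) by (apply pow_lt; lra).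
assert (HwU5 : w ^ 5 * U ^ 5 = 1) by (rewrite <- Rpow_mult_distr, HwU; ring).
assert (Hbc : 0 < b * c) by (apply Rmult_lt_0_compat; lra).
assert (Hxbc : 0 < x * (b * c * (b + c)))
  by (apply Rmult_lt_0_compat; [lra | apply Rmult_lt_0_compat; lra]).
assert (Hlow : x * (b * c * (b + c)) * (11.8 * A * w ^ 5) <= x * (b * c * (b + c) * (P - P'))).
{ replace (x * (b * c * (b + c) * (P - P'))) with (x * (b * c * (b + c)) * (P - P')) by ring.
  apply Rmult_le_compat_l; lra. }
assert (Hup : x * (b * c * (b + c) * (P - P')) <= x * (b * c * (b + c)) * (12 * A * w ^ 5)).
{ replace (x * (b * c * (b + c) * (P - P'))) with (x * (b * c * (b + c)) * (P - P')) by ring.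
  apply Rmult_le_compat_l; lra. }
assert (Hd5 : d = h * U ^ 3 * w ^ 5).
{ unfold d; replace (h * U ^ 3 * w ^ 5) with (h * w ^ 2 * (w * U) ^ 3) by ring.
  rewrite HwU; ring. }
(* Spacing of both gaps and of the shift gives x b c A >= 1.3 U^4, which beats the error 2 h U^3. *)
assert (Hpos : 2 * (b + c) * d < x * (b * c * (b + c)) * (11.8 * A * w ^ 5)).
{ rewrite Hd5.
  replace (2 * (b + c) * (h * U ^ 3 * w ^ 5)) with (2 * h * U ^ 3 * ((b + c) * w ^ 5)) by ring.
  replace (x * (b * c * (b + c)) * (11.8 * A * w ^ 5))
    with (11.8 * (x * (b * c * A)) * ((b + c) * w ^ 5)) by ring.
  apply Rmult_lt_compat_r; [apply Rmult_lt_0_compat; lra|].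
  assert (HU3 : 0 < U ^ 3) by (apply pow_lt; lra).
  assert (h * U ^ 3 <= U * U ^ 3) by (apply Rmult_le_compat_r; lra).
  lra. }
specialize (HI1 ltac:(lra)).
assert (Hsmall : 2 * (b + c) * d <= 0.001).
{ unfold d.
  apply Rle_trans with (2 * (U / 500) * (h * w ^ 2)).
  - apply Rmult_le_compat_r; [|lra].
    apply Rmult_le_pos; [lra | apply pow_le; lra].
  - replace (2 * (U / 500) * (h * w ^ 2)) with (h * w / 250 * (w * U)) by field.
    rewrite HwU.
    assert (600 * h * w <= U * w) by (apply Rmult_le_compat_r; lra).
    lra. }
assert (K : 0.999 <= x * (b * c * (b + c)) * (12 * A * w ^ 5)) by lra.
assert (HU5 : 0 < U ^ 5) by (apply pow_lt; lra).
assert (K2 : 0.999 * U ^ 5 <= x * (b * c * (b + c)) * (12 * A * w ^ 5) * U ^ 5)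
  by (apply Rmult_le_compat_r; lra).
replace (x * (b * c * (b + c)) * (12 * A * w ^ 5) * U ^ 5)
  with (3 * (x * A * (b + c) * (4 * (b * c))) * (w ^ 5 * U ^ 5)) in K2 by ring.
rewrite HwU5 in K2.
assert (K3 : x * A * (b + c) * (4 * (b * c)) <= x * A * (b + c) * (b + c) ^ 2).
{ apply Rmult_le_compat_l; [|apply four_mul_le].
  apply Rmult_le_pos; [apply Rmult_le_pos|]; lra. }
lra.
Qed.

(** * Fibres of the determinant *)

(** All points lie within W of the least one, and u / q is a potential for triples. *)
Lemma at_most_diameter2 (P : Z -> Prop) (W q : R) :
  0 <= W -> 0 < q ->
  (forall u v, P u -> P v -> (u < v)%Z -> IZR v - IZR u <= W) ->
  (forall u v w, P u -> P v -> P w -> (u < v < w)%Z -> q <= IZR w - IZR u) ->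
  at_most P (2 * (1 + W / q)).
Proof.
intros HW Hq Hd H3; apply at_most_sorted; intros l Hs Hin.
assert (HWq : 0 <= W / q) by (apply Rmult_le_pos; [lra | left; apply Rinv_0_lt_compat; lra]).
destruct l as [|u l]; [simpl; lra|].
replace (W / q) with ((IZR u / q + W / q) - IZR u / q) by ring.
assert (Hqi : 0 < / q) by (apply Rinv_0_lt_compat; lra).
apply (at_most_potential2 (fun v => In v (u :: l)) (fun v => IZR v / q)); auto.
- lra.
- intros v [<- | Hv]; [lra|].
  apply sorted_cons in Hs as [_ Hu].
  assert (u < v)%Z by auto.
  assert (IZR u < IZR v) by now apply IZR_lt.
  assert (IZR v - IZR u <= W) by (apply Hd; auto; apply Hin; simpl; auto).
  unfold Rdiv; split; [apply Rmult_le_compat_r; lra|].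
  rewrite <- Rmult_plus_distr_r; apply Rmult_le_compat_r; lra.
- intros a b c Ha Hb Hc Habc.
  assert (q <= IZR c - IZR a) by (apply H3 with b; auto).
  replace 1 with (q / q) by (field; lra); unfold Rdiv; rewrite <- Rmult_plus_distr_r.
  apply Rmult_le_compat_r; lra.
- now apply sorted_NoDup.
Qed.

(** A discrete comparison with an integral, F playing the primitive of f. *)
Lemma Rlist_sum_telescope (f F : nat -> R) (n k : nat) :
  (forall i, (n <= i)%nat -> f (S i) <= F (S i) - F i) ->
  Rlist_sum f (seq (S n) k) <= F (n + k)%nat - F n.
Proof.
intros H; induction k as [|k IH].
- simpl; replace (n + 0)%nat with n by lia; lra.
- rewrite seq_S, Rlist_sum_app; simpl.
  replace (n + S k)%nat with (S (n + k)) by lia.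
  specialize (H (n + k)%nat ltac:(lia)); lra.
Qed.

Lemma root3_step (i : nat) : (0 < i)%nat ->
  let p := root 3 (INR (S i)) in let q := root 3 (INR i) in
  0 < q <= p /\ 1 <= 3 * p ^ 2 * (p - q).
Proof.
intros Hi p q.
assert (Hi1 : 1 <= INR i) by (apply (le_INR 1); lia).
assert (Hp : p ^ 3 = INR i + 1)
  by (unfold p; rewrite root_pow, S_INR; try lia; try lra; rewrite S_INR; lra).
assert (Hq : q ^ 3 = INR i) by (apply root_pow; [lia | lra]).
assert (Hq0 : 0 < q) by apply root_pos.
assert (Hqp : q <= p).
{ apply root_le; [lia|]; rewrite S_INR; lra. }
repeat split; auto.
assert (E : p ^ 3 - q ^ 3 = (p - q) * (p ^ 2 + p * q + q ^ 2)) by ring.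
rewrite Hp, Hq in E.
assert (p ^ 2 + p * q + q ^ 2 <= 3 * p ^ 2) by nra.
assert ((p - q) * (p ^ 2 + p * q + q ^ 2) <= (p - q) * (3 * p ^ 2))
  by (apply Rmult_le_compat_l; lra).
lra.
Qed.

Lemma sum_inv_root3_sq (N : nat) : (0 < N)%nat ->
  Rlist_sum (fun i => / root 3 (INR i) ^ 2) (seq 1 N) <= 3 * root 3 (INR N).
Proof.
intros HN.
(* The value at 0 is set by hand: [root 3 0] is 1, since [ln 0] is 0 by convention. *)
set (F := fun i => match i with O => 0 | S _ => 3 * root 3 (INR i) end).
assert (H := Rlist_sum_telescope (fun i => / root 3 (INR i) ^ 2) F 0 N).
destruct N as [|N]; [lia|]; unfold F at 3 4 in H; cbn [plus] in H.
assert (Hs : forall i, (0 <= i)%nat -> / root 3 (INR (S i)) ^ 2 <= F (S i) - F i).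
{ intros [|i] _.
  - simpl F.
    assert (E : root 3 (INR 1) = 1).
    { unfold root; simpl; unfold Rpower; rewrite ln_1, Rmult_0_r; apply exp_0. }
    simpl INR in E; simpl INR; rewrite E; lra.
  - destruct (root3_step (S i) ltac:(lia)) as [Hpq Hst].
    unfold F.
    set (p := root 3 (INR (S (S i)))) in *; set (q := root 3 (INR (S i))) in *.
    assert (Hp2 : 0 < p ^ 2) by (apply pow_lt; lra).
    apply Rmult_le_reg_l with (p ^ 2); auto; rewrite Rinv_r by lra; lra. }
specialize (H Hs); lra.
Qed.

Lemma sum_inv_root3_fourth (n k : nat) : (0 < n)%nat ->
  Rlist_sum (fun i => / root 3 (INR i) ^ 4) (seq (S n) k) <= 3 / root 3 (INR n).
Proof.
intros Hn.
assert (H := Rlist_sum_telescope (fun i => / root 3 (INR i) ^ 4)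
  (fun i => - (3 / root 3 (INR i))) n k).
assert (Hs : forall i, (n <= i)%nat ->
  / root 3 (INR (S i)) ^ 4 <= - (3 / root 3 (INR (S i))) - - (3 / root 3 (INR i))).
{ intros i Hi; destruct (root3_step i ltac:(lia)) as [Hpq Hst].
  set (p := root 3 (INR (S i))) in *; set (q := root 3 (INR i)) in *.
  apply Rmult_le_reg_r with (p ^ 4 * q); [apply Rmult_lt_0_compat; [apply pow_lt|]; lra|].
  replace (/ p ^ 4 * (p ^ 4 * q)) with q by (field; lra).
  replace ((- (3 / p) - - (3 / q)) * (p ^ 4 * q)) with (3 * p ^ 2 * (p - q) * p)
    by (field; lra).
  apply Rle_trans with (1 * p); [lra | apply Rmult_le_compat_r; lra]. }
specialize (H Hs).
assert (0 < 3 / root 3 (INR (n + k))).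
{ apply Rdiv_lt_0_compat; [lra | apply root_pos]. }
lra.
Qed.

(** Termwise 1/(i+1) <= - ln (1 - 1/(i+1)), which follows from 1 + y <= exp y. *)
Lemma sum_inv_ln (n k : nat) : (0 < n)%nat ->
  Rlist_sum (fun i => / INR i) (seq (S n) k) <= ln (INR (n + k)) - ln (INR n).
Proof.
intros Hn; apply (Rlist_sum_telescope (fun i => / INR i) (fun i => ln (INR i)) n k).
intros i Hi.
assert (Hi1 : 1 <= INR i) by (apply (le_INR 1); lia).
rewrite S_INR.
assert (E : ln (INR i) = ln (INR i + 1) + ln (INR i / (INR i + 1))).
{ rewrite <- ln_mult; [f_equal; field; lra | lra | apply Rdiv_lt_0_compat; lra]. }
assert (Hl : ln (INR i / (INR i + 1)) <= - / (INR i + 1)).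
{ assert (Hpos : 0 < INR i / (INR i + 1)) by (apply Rdiv_lt_0_compat; lra).
  assert (H := exp_ineq1_le (ln (INR i / (INR i + 1)))).
  rewrite exp_ln in H by auto.
  replace (INR i / (INR i + 1)) with (1 - / (INR i + 1)) in H at 2 by (field; lra); lra. }
lra.
Qed.

(** A set of near points above T after thinning, when any two of them are spaced. *)
Definition spaced_near (x h T : R) (Q : Z -> Prop) : Prop :=
  (forall u, Q u -> near x h u /\ T < IZR u) /\
  (forall u v, Q u -> Q v -> (u < v)%Z -> spaced x u v).

(** Spacing of u and u + a says x a^3 >= 1.3 u^4, so the main term is at least 1.29, while the error
    is at most 2/600. Hence the determinant is a positive integer. *)
Lemma det_estimate (x h T : R) (Q : Z -> Prop) (a u : Z) :
  regime x h -> spaced_near x h T Q -> 600 * h <= T -> (0 < a)%Z ->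
  Q u -> Q (u + a)%Z -> IZR a <= IZR u / 8000 ->
  1 <= IZR (det x a u) /\
  Rabs (IZR (det x a u) - det_main x (IZR a) (IZR u)) <= 2 * h / IZR u /\
  2 * h / IZR u <= 0.004 /\
  1.29 <= det_main x (IZR a) (IZR u).
Proof.
intros (Hh & Hh3 & Hx) [HQ HS] HT Ha Qu Qa HaU.
destruct (HQ u Qu) as [Nu Hu]; destruct (HQ _ Qa) as [Na _].
assert (Sp := HS u (u + a)%Z Qu Qa ltac:(lia)); unfold spaced in Sp.
rewrite plus_IZR in Sp.
assert (HA : 1 <= IZR a) by (apply IZR_le; lia).
assert (Happ := det_approx x h a u ltac:(lra) Nu Na Ha ltac:(lra) ltac:(nra)).
assert (Hb := det_main_bounds x (IZR a) (IZR u) ltac:(lra) ltac:(lra) ltac:(lra) HaU).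
set (U := IZR u) in *; set (A := IZR a) in *.
replace (U + A - U) with A in Sp by ring.
assert (HU4 : 0 < U ^ 4) by (apply pow_lt; lra).
assert (Hmain : 1.29 <= det_main x A U) by (apply Rmult_le_reg_r with (U ^ 4); lra).
assert (Hsm : 2 * h / U <= 0.004).
{ apply Rmult_le_reg_r with U; [lra|].
  unfold Rdiv; rewrite Rmult_assoc, Rinv_l by lra; lra. }
repeat split; auto.
apply IZR_pos_ge1.
assert (H := Rle_abs (- (IZR (det x a u) - det_main x A U))).
rewrite Rabs_Ropp in H; lra.
Qed.

(** Equal determinants force the main terms at u and v to differ by at most 4 h / u, whereas the
    main term decays by a relative amount of nearly 4 (v - u) / u. *)
Lemma fibre_diameter (x h T : R) (Q : Z -> Prop) (a u v : Z) :
  regime x h -> spaced_near x h T Q -> 600 * h <= T -> (0 < a)%Z ->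
  Q u -> Q (u + a)%Z -> Q v -> Q (v + a)%Z -> (u < v)%Z ->
  IZR a <= IZR u / 8000 -> det x a u = det x a v ->
  (IZR v - IZR u) * IZR (det x a u) <= 1.04 * h.
Proof.
intros Hr Hsn HT Ha Qu Qua Qv Qva Huv HaU E.
assert (HUV : IZR u < IZR v) by now apply IZR_lt.
destruct (det_estimate x h T Q a u Hr Hsn HT Ha Qu Qua HaU) as (D1 & B1 & S1 & M1).
destruct (det_estimate x h T Q a v Hr Hsn HT Ha Qv Qva ltac:(lra)) as (D2 & B2 & S2 & M2).
destruct (proj1 Hsn u Qu) as [_ HuT].
rewrite <- E in B2, D2.
assert (HA : 1 <= IZR a) by (apply IZR_le; lia).
assert (Hh : 20000 <= h) by (destruct Hr; lra).
assert (Hx : 0 < x) by (destruct Hr; lra).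
set (D := IZR (det x a u)) in *; set (A := IZR a) in *.
assert (Hdec := det_main_decay x A (IZR u) (IZR v) Hx ltac:(lra) ltac:(lra) HaU).
set (U := IZR u) in *; set (V := IZR v) in *.
assert (X1 := Rle_abs (- (D - det_main x A U))); rewrite Rabs_Ropp in X1.
assert (X2 := Rle_abs (D - det_main x A V)).
set (g := det_main x A V) in *.
assert (HVU : 2 * h / V <= 2 * h / U).
{ apply Rmult_le_compat_l; [lra | apply Rinv_le_contravar; lra]. }
assert (K : g * (3.98 * (V - U) / U) <= 4 * h / U).
{ replace (4 * h / U) with (2 * h / U + 2 * h / U) by (field; lra); lra. }
assert (K2 : g * (3.98 * (V - U)) <= 4 * h).
{ apply Rmult_le_reg_r with (/ U); [apply Rinv_0_lt_compat; lra|].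
  replace (g * (3.98 * (V - U)) * / U) with (g * (3.98 * (V - U) / U)) by (unfold Rdiv; ring).
  exact K. }
assert (0.99 * D * (V - U) <= g * (V - U)) by (apply Rmult_le_compat_r; lra).
lra.
Qed.

(** The bound of [near_pairs_three] rewritten with x a^3 / u^4 replaced by the determinant, which
    removes x. *)
Lemma fibre_three (x h T : R) (Q : Z -> Prop) (a u1 u2 u3 : Z) :
  regime x h -> spaced_near x h T Q -> 600 * h <= T -> (0 < a)%Z ->
  Q u1 -> Q (u1 + a)%Z -> Q u2 -> Q (u2 + a)%Z -> Q u3 -> Q (u3 + a)%Z ->
  (u1 < u2 < u3)%Z -> IZR a <= IZR u1 / 8000 -> det x a u1 = det x a u3 ->
  0.31 * (IZR u1 * IZR a ^ 2) <= IZR (det x a u1) * (IZR u3 - IZR u1) ^ 3.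
Proof.
intros Hr Hsn HT Ha Q1 Q1a Q2 Q2a Q3 Q3a Hu HaU E.
assert (Hd := fibre_diameter x h T Q a u1 u3 Hr Hsn HT Ha Q1 Q1a Q3 Q3a ltac:(lia) HaU E).
destruct (det_estimate x h T Q a u1 Hr Hsn HT Ha Q1 Q1a HaU) as (D1 & B1 & S1 & M1).
assert (Hh : 20000 <= h) by (destruct Hr; lra).
assert (Hx : 0 < x) by (destruct Hr; lra).
assert (HA : 1 <= IZR a) by (apply IZR_le; lia).
assert (HUW : IZR u1 < IZR u3) by (apply IZR_lt; lia).
destruct Hsn as [HQ HS].
destruct (HQ u1 Q1) as [N1 HuT].
(* The diameter is at most 1.04 h, and 500 * 1.04 < 600. *)
assert (Hcl : IZR u3 - IZR u1 <= IZR u1 / 500).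
{ assert ((IZR u3 - IZR u1) * 1 <= (IZR u3 - IZR u1) * IZR (det x a u1))
    by (apply Rmult_le_compat_l; lra). lra. }
assert (K : 0.32 * IZR u1 ^ 5 <= x * IZR a * (IZR u3 - IZR u1) ^ 3).
{ apply near_pairs_three with h u2; auto; try (apply HQ; auto); try (apply HS; auto; lia); lra. }
assert (Hb := det_main_bounds x (IZR a) (IZR u1) Hx ltac:(lra) ltac:(lra) HaU).
set (D := IZR (det x a u1)) in *; set (A := IZR a) in *.
set (U := IZR u1) in *; set (W := IZR u3) in *.
assert (X1 := Rle_abs (- (D - det_main x A U))); rewrite Rabs_Ropp in X1.
assert (HU4 : 0 < U ^ 4) by (apply pow_lt; lra).
assert (HgD : det_main x A U <= 1.004 * D) by lra.
assert (K2 : det_main x A U * U ^ 4 <= 1.004 * D * U ^ 4) by (apply Rmult_le_compat_r; lra).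
apply Rmult_le_reg_l with (x * A); [apply Rmult_lt_0_compat; lra|].
assert (K3 : D * (0.32 * U ^ 5) <= D * (x * A * (W - U) ^ 3)) by (apply Rmult_le_compat_l; lra).
assert (K4 : U * (0.999 * (x * A ^ 3)) <= U * (1.004 * D * U ^ 4))
  by (apply Rmult_le_compat_l; lra).
assert (0 < x * A ^ 3 * U)
  by (apply Rmult_lt_0_compat; [apply Rmult_lt_0_compat; [|apply pow_lt]|]; lra).
lra.
Qed.

(* By fibre_diameter all points lie within 1.04 h / i, and by fibre_three any three of them
   span at least a constant times (m a^2 / i)^(1/3). *)
Lemma fibre_count (x h T m : R) (Q : Z -> Prop) (a : Z) (i : nat) :
  regime x h -> spaced_near x h T Q -> 600 * h <= T -> (0 < a)%Z -> 0 < m -> (0 < i)%nat ->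
  at_most (fun u => (Q u /\ Q (u + a)%Z /\ IZR a <= IZR u / 8000 /\ m <= IZR u)
                    /\ det x a u = Z.of_nat i)
    (2 + 3.08 * h / root 3 (m * IZR a ^ 2) * / root 3 (INR i) ^ 2).
Proof.
intros Hr Hsn HT Ha Hm Hi.
assert (Hh : 20000 <= h) by (destruct Hr; lra).
assert (HA : 1 <= IZR a) by (apply IZR_le; lia).
assert (Hi1 : 1 <= INR i) by (apply (le_INR 1); lia).
assert (HmA : 0 < m * IZR a ^ 2) by (apply Rmult_lt_0_compat; [|apply pow_lt]; lra).
assert (Ek : root 3 (m * IZR a ^ 2) ^ 3 = m * IZR a ^ 2) by (apply root_pow; [lia | auto]).
assert (Ed : root 3 (INR i) ^ 3 = INR i) by (apply root_pow; [lia | lra]).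
assert (Hk := root_pos 3 (m * IZR a ^ 2)); assert (Hd := root_pos 3 (INR i)).
set (k := root 3 (m * IZR a ^ 2)) in *; set (d := root 3 (INR i)) in *.
(* 0.676 is just below the cube root of 0.31, and 2 * 1.04 / 0.676 < 3.08. *)
apply at_most_mono with (Q := fun u =>
  (Q u /\ Q (u + a)%Z /\ IZR a <= IZR u / 8000 /\ m <= IZR u) /\ det x a u = Z.of_nat i)
  (r := 2 * (1 + (1.04 * h / INR i) / (0.676 * k / d))); auto.
{ rewrite <- Ed.
  replace (1.04 * h / d ^ 3 / (0.676 * k / d)) with (1.04 / 0.676 * (h / k * / d ^ 2))
    by (field; lra).
  replace (3.08 * h / k * / d ^ 2) with (3.08 * (h / k * / d ^ 2)) by (unfold Rdiv; ring).
  assert (0 < h / k * / d ^ 2).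
  { apply Rmult_lt_0_compat; [apply Rdiv_lt_0_compat; lra|].
    apply Rinv_0_lt_compat, pow_lt; lra. }
  lra. }
apply at_most_diameter2.
- apply Rmult_le_pos; [lra | left; apply Rinv_0_lt_compat; lra].
- apply Rdiv_lt_0_compat; lra.
- intros u v [(Qu & Qua & HaU & Hmu) Eu] [(Qv & Qva & HaV & Hmv) Ev] Huv.
  assert (H := fibre_diameter x h T Q a u v Hr Hsn HT Ha Qu Qua Qv Qva Huv HaU ltac:(congruence)).
  rewrite Eu, <- INR_IZR_INZ in H.
  apply Rmult_le_reg_r with (INR i); [lra|].
  unfold Rdiv; rewrite Rmult_assoc, Rinv_l by lra; lra.
- intros u v w [(Qu & Qua & HaU & Hmu) Eu] [(Qv & Qva & HaV & Hmv) Ev]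
    [(Qw & Qwa & HaW & Hmw) Ew] Huvw.
  assert (H := fibre_three x h T Q a u v w Hr Hsn HT Ha Qu Qua Qv Qva Qw Qwa Huvw HaU
    ltac:(congruence)).
  rewrite Eu, <- INR_IZR_INZ in H.
  assert (IZR u < IZR w) by (apply IZR_lt; lia).
  apply (pow_le_cancel 3); [lia | lra |].
  apply Rmult_le_reg_l with (INR i); [lra|].
  replace (INR i * (0.676 * k / d) ^ 3) with (0.676 ^ 3 * k ^ 3)
    by (rewrite <- Ed; field; lra).
  rewrite Ek.
  assert (m * IZR a ^ 2 <= IZR u * IZR a ^ 2)
    by (apply Rmult_le_compat_r; [apply pow_le|]; lra).
  lra.
Qed.

(* Sums fibre_count over the possible values 1 <= det <= 1.01 x a^3 / m^4; the free parameter e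
   stands for the cube root of x a / m^5. *)
Lemma pair_count (x h T m e : R) (Q : Z -> Prop) (a : Z) :
  regime x h -> spaced_near x h T Q -> 600 * h <= T -> (0 < a)%Z -> 0 < m -> 0 < e ->
  x * IZR a <= e ^ 3 * m ^ 5 ->
  at_most (fun u => Q u /\ Q (u + a)%Z /\ IZR a <= IZR u / 8000 /\ m <= IZR u)
    (2.05 * (x * IZR a ^ 3 / m ^ 4) + 9.4 * h * e).
Proof.
intros Hr Hsn HT Ha Hm He Hem.
assert (Hh : 20000 <= h) by (destruct Hr; lra).
assert (Hx : 0 < x) by (destruct Hr; lra).
assert (HA : 1 <= IZR a) by (apply IZR_le; lia).
set (P := fun u => Q u /\ Q (u + a)%Z /\ IZR a <= IZR u / 8000 /\ m <= IZR u).
assert (HA3 : 0 < x * IZR a ^ 3) by (apply Rmult_lt_0_compat; [|apply pow_lt]; lra).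
assert (Hm4 : 0 < m ^ 4) by (apply pow_lt; lra).
assert (Hy : 0 < x * IZR a ^ 3 / m ^ 4) by (apply Rdiv_lt_0_compat; auto).
set (y := x * IZR a ^ 3 / m ^ 4) in *.
(* The error 0.004 fits into 0.01 y, because y is at least the main term, hence at least 1.29. *)
assert (Hdet : forall u, P u -> 1 <= IZR (det x a u) <= 1.01 * y).
{ intros u (Qu & Qua & HaU & Hmu).
  destruct (det_estimate x h T Q a u Hr Hsn HT Ha Qu Qua HaU) as (D1 & B1 & S1 & M1).
  split; auto.
  assert (HU : 0 < IZR u) by lra.
  assert (Hb := proj2 (det_main_bounds x (IZR a) (IZR u) Hx ltac:(lra) HU HaU)).
  assert (X2 := Rle_abs (IZR (det x a u) - det_main x (IZR a) (IZR u))).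
  assert (det_main x (IZR a) (IZR u) <= y); [|lra].
  unfold y; apply Rmult_le_reg_r with (m ^ 4); auto.
  unfold Rdiv; rewrite Rmult_assoc, Rinv_l, Rmult_1_r by lra.
  apply Rle_trans with (2 := Hb); apply Rmult_le_compat_l; [lra|].
  apply pow_incr; lra. }
destruct (archimed (1.01 * y)) as [Hup1 Hup2].
destruct (Rlt_le_dec (1.01 * y) 1) as [Hlt | Hge].
{ apply at_most_mono with (Q := P) (r := 0); auto.
  - assert (0 < h * e) by (apply Rmult_lt_0_compat; lra); lra.
  - apply at_most_false; intros u Pu; specialize (Hdet u Pu); lra. }
set (N := Z.to_nat (up (1.01 * y) - 1)).
assert (Hup : (1 < up (1.01 * y))%Z) by (apply lt_IZR; lra).
assert (HN : INR N = IZR (up (1.01 * y)) - 1).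
{ unfold N; rewrite INR_IZR_INZ, Z2Nat.id, minus_IZR; auto; lia. }
assert (HN0 : (0 < N)%nat) by (unfold N; lia).
assert (HN1 : 1 <= INR N) by (apply (le_INR 1); lia).
assert (Hsum := at_most_sum (fun i u => P u /\ det x a u = Z.of_nat i)
  (fun i => 2 + 3.08 * h / root 3 (m * IZR a ^ 2) * / root 3 (INR i) ^ 2) (seq 1 N)).
assert (Hf : forall i, In i (seq 1 N) -> at_most (fun u => P u /\ det x a u = Z.of_nat i)
  (2 + 3.08 * h / root 3 (m * IZR a ^ 2) * / root 3 (INR i) ^ 2)).
{ intros i Hi; apply in_seq in Hi; apply fibre_count with T; auto; lia. }
specialize (Hsum Hf); clear Hf.
rewrite Rlist_sum_plus, Rlist_sum_scal, Rlist_sum_const, length_seq in Hsum.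
eapply at_most_mono; [| | exact Hsum].
- intros u Pu; exists (Z.to_nat (det x a u)).
  destruct (Hdet u Pu) as [D1 D2].
  assert (H1 : (1 <= det x a u)%Z) by (apply le_IZR; lra).
  assert (H2 : (det x a u < up (1.01 * y))%Z) by (apply lt_IZR; lra).
  split; [apply in_seq; unfold N; lia | split; auto; lia].
- assert (HmA : 0 < m * IZR a ^ 2) by (apply Rmult_lt_0_compat; [|apply pow_lt]; lra).
  assert (Ek : root 3 (m * IZR a ^ 2) ^ 3 = m * IZR a ^ 2) by (apply root_pow; [lia | auto]).
  assert (Ed : root 3 (INR N) ^ 3 = INR N) by (apply root_pow; [lia | lra]).
  assert (Hk := root_pos 3 (m * IZR a ^ 2)); assert (Hd := root_pos 3 (INR N)).
  assert (Hs := sum_inv_root3_sq N HN0).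
  set (k := root 3 (m * IZR a ^ 2)) in *; set (d := root 3 (INR N)) in *.
  (* Since N <= 1.01 y, y <= e^3 k^3 and 1.005^3 > 1.01. *)
  assert (Hde : d <= 1.005 * (e * k)).
  { apply (pow_le_cancel 3); [lia | apply Rmult_le_pos; [lra | apply Rmult_le_pos; lra] |].
    rewrite !Rpow_mult_distr, Ek, Ed.
    assert (Hey : y <= e ^ 3 * (m * IZR a ^ 2)).
    { unfold y; apply Rmult_le_reg_r with (m ^ 4); auto.
      unfold Rdiv; rewrite Rmult_assoc, Rinv_l, Rmult_1_r by lra.
      replace (x * IZR a ^ 3) with (x * IZR a * IZR a ^ 2) by ring.
      replace (e ^ 3 * (m * IZR a ^ 2) * m ^ 4) with (e ^ 3 * m ^ 5 * IZR a ^ 2) by ring.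
      apply Rmult_le_compat_r; [apply pow_le|]; lra. }
    lra. }
  assert (H1 : 3.08 * h / k * Rlist_sum (fun i => / root 3 (INR i) ^ 2) (seq 1 N)
    <= 3.08 * h / k * (3 * (1.005 * (e * k)))).
  { apply Rmult_le_compat_l; [|lra].
    left; apply Rdiv_lt_0_compat; lra. }
  replace (3.08 * h / k * (3 * (1.005 * (e * k)))) with (3.08 * 3 * 1.005 * (h * e)) in H1
    by (field; lra).
  assert (0 < h * e) by (apply Rmult_lt_0_compat; lra).
  lra.
Qed.

Lemma floor_nat (y : R) : 0 <= y -> exists n : nat, INR n <= y < INR n + 1.
Proof.
intros Hy; destruct (archimed y) as [H1 H2].
assert (Hup : (0 < up y)%Z) by (apply lt_IZR; lra).
exists (Z.to_nat (up y - 1)).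
rewrite INR_IZR_INZ, Z2Nat.id, minus_IZR by lia; lra.
Qed.

Lemma ln_le_mono (a b : R) : 0 < a -> a <= b -> ln a <= ln b.
Proof. intros Ha [Hab | ->]; [left; now apply ln_increasing | lra]. Qed.

(* The cutoff 8/27 for a w / u balances pairs against isolated points and has a rational cube
   root. For a <= (8/27) kap^3 the bound u >= w kap^3 is the stronger one, for larger a it is
   u >= (27/8) a w. *)
Lemma pairs_total (x h w kap : R) (Q : Z -> Prop) :
  regime x h -> 0 < w -> w ^ 5 = x -> 5 <= kap -> 600 * h <= w * kap ^ 3 ->
  spaced_near x h (w * kap ^ 3) Q -> (forall u, Q u -> IZR u <= w ^ 2) ->
  at_most (fun u => exists a, (0 < a)%Z /\ IZR a * w <= 8 / 27 * IZR u /\ Q u /\ Q (u + a)%Z)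
    (0.016 * w * (1 + ln w) + 7.6 * h / kap).
Proof.
intros Hr Hw Hwx Hk HT Hsn HQw.
assert (Hw' : 2400 <= w).
{ apply (pow_le_cancel 5); [lia | lra |]; destruct Hr; lra. }
assert (Hh : 20000 <= h) by (destruct Hr; lra).
assert (Hk3 : 125 <= kap ^ 3).
{ replace 125 with (5 ^ 3) by ring; apply pow_incr; lra. }
(* The distance n separates the two regimes for the lower bound on u; N is the largest possible
   distance, since u <= w^2. *)
destruct (floor_nat (8 / 27 * kap ^ 3)) as (n & Hn1 & Hn2); [lra|].
destruct (floor_nat (8 / 27 * w)) as (N & HN1 & HN2); [lra|].
assert (Hn0 : (0 < n)%nat) by (apply INR_lt; simpl; lra).
assert (Hn : 1 <= INR n) by (apply (le_INR 1); lia).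
set (P := fun (m : R) (i : nat) u => Q u /\ Q (u + Z.of_nat i)%Z
  /\ IZR (Z.of_nat i) <= IZR u / 8000 /\ m <= IZR u).
assert (HkP : 0 < kap ^ 4) by (apply pow_lt; lra).
(* Each distance is charged as much as the largest one, (8/27) kap^3, for which e^3 m^5 = x a with e
   = (2/3) / kap^4. *)
assert (S1 := at_most_sum (P (w * kap ^ 3))
  (fun _ => 2.05 * (w * (8 / 27) ^ 3 / kap ^ 3) + 9.4 * h * (2 / 3 / kap ^ 4)) (seq 1 n)).
assert (F1 : forall i, In i (seq 1 n) -> at_most (P (w * kap ^ 3) i)
  (2.05 * (w * (8 / 27) ^ 3 / kap ^ 3) + 9.4 * h * (2 / 3 / kap ^ 4))).
{ intros i Hi; apply in_seq in Hi.
  assert (Hi1 : 1 <= INR i) by (apply (le_INR 1); lia).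
  assert (Hin : INR i <= INR n) by (apply le_INR; lia).
  eapply at_most_mono; [intros u Hu; exact Hu | |
    apply pair_count with (x := x) (h := h) (Q := Q) (a := Z.of_nat i) (T := w * kap ^ 3)
      (e := 2 / 3 / kap ^ 4) (m := w * kap ^ 3)]; auto.
  - apply Rplus_le_compat_r, Rmult_le_compat_l; [lra|].
    rewrite <- INR_IZR_INZ, <- Hwx.
    replace (w ^ 5 * INR i ^ 3 / (w * kap ^ 3) ^ 4) with (w / kap ^ 12 * INR i ^ 3)
      by (field; lra).
    replace (w * (8 / 27) ^ 3 / kap ^ 3) with (w / kap ^ 12 * (8 / 27 * kap ^ 3) ^ 3)
      by (field; lra).
    apply Rmult_le_compat_l; [|apply pow_incr; lra].
    apply Rmult_le_pos; [lra | left; apply Rinv_0_lt_compat, pow_lt; lra].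
  - lia.
  - apply Rmult_lt_0_compat; lra.
  - apply Rdiv_lt_0_compat; lra.
  - rewrite <- INR_IZR_INZ, <- Hwx.
    replace ((2 / 3 / kap ^ 4) ^ 3 * (w * kap ^ 3) ^ 5) with (w ^ 5 * (8 / 27 * kap ^ 3))
      by (field; lra).
    apply Rmult_le_compat_l; [apply pow_le|]; lra. }
specialize (S1 F1); clear F1; rewrite Rlist_sum_const, length_seq in S1.
(* With m = (27/8) i w and e = (2/3)^5 i^(-4/3), e^3 m^5 = x i exactly, and x i^3 / m^4 = (8/27)^4 w
   / i. *)
assert (S2 := at_most_sum (fun i => P (INR i * w / (8 / 27)) i)
  (fun i => 2.05 * w * (8 / 27) ^ 4 * / INR i
    + 9.4 * h * (2 / 3) ^ 5 * / root 3 (INR i) ^ 4) (seq (S n) (N - n))).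
assert (F2 : forall i, In i (seq (S n) (N - n)) -> at_most (P (INR i * w / (8 / 27)) i)
  (2.05 * w * (8 / 27) ^ 4 * / INR i + 9.4 * h * (2 / 3) ^ 5 * / root 3 (INR i) ^ 4)).
{ intros i Hi; apply in_seq in Hi.
  assert (Hi1 : 1 <= INR i) by (apply (le_INR 1); lia).
  assert (Hm : 0 < INR i * w / (8 / 27)).
  { apply Rdiv_lt_0_compat; [apply Rmult_lt_0_compat|]; lra. }
  assert (Hp := root_pos 3 (INR i)).
  assert (Hp3 : root 3 (INR i) ^ 3 = INR i) by (apply root_pow; [lia | lra]).
  assert (Hp4 : 0 < root 3 (INR i) ^ 4) by (apply pow_lt; lra).
  eapply at_most_mono; [intros u Hu; exact Hu | |
    apply pair_count with (x := x) (h := h) (Q := Q) (a := Z.of_nat i) (T := w * kap ^ 3)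
      (e := (2 / 3) ^ 5 / root 3 (INR i) ^ 4)
      (m := INR i * w / (8 / 27))]; auto.
  - right; rewrite <- INR_IZR_INZ, <- Hwx.
    unfold Rdiv at 4; rewrite <- !Rmult_assoc; f_equal.
    rewrite !Rmult_assoc; f_equal; field; lra.
  - lia.
  - apply Rdiv_lt_0_compat; lra.
  - right; rewrite <- INR_IZR_INZ, <- Hwx.
    transitivity (w ^ 5 * (INR i ^ 5 / (root 3 (INR i) ^ 3) ^ 4)).
    + rewrite Hp3; field; lra.
    + field; lra. }
specialize (S2 F2); clear F2.
rewrite Rlist_sum_plus, !Rlist_sum_scal in S2.
assert (HS := at_most_or _ _ _ _ S1 S2).
eapply at_most_mono; [| | exact HS].
- intros u (a & Ha & Hau & Qu & Qa).
  assert (HA : 1 <= IZR a) by (apply IZR_le; lia).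
  assert (Hun := HQw u Qu); destruct (proj1 Hsn u Qu) as [_ HuT].
  assert (HaN : IZR a <= 8 / 27 * w).
  { apply Rmult_le_reg_r with w; lra. }
  assert (Ea : Z.of_nat (Z.to_nat a) = a) by (apply Z2Nat.id; lia).
  assert (EA : INR (Z.to_nat a) = IZR a) by (rewrite INR_IZR_INZ, Ea; auto).
  assert (HaN' : (Z.to_nat a <= N)%nat).
  { apply Nat.lt_succ_r, INR_lt; rewrite S_INR, EA; lra. }
  (* From w >= 2400: (8/27) / 2400 = 1/8100. *)
  assert (Ha8 : IZR a <= IZR u / 8000).
  { assert (IZR a * 2400 <= IZR a * w) by (apply Rmult_le_compat_l; lra). lra. }
  destruct (le_lt_dec (Z.to_nat a) n) as [Hle | Hgt].
  + left; exists (Z.to_nat a); unfold P; rewrite Ea; split; [apply in_seq; lia|].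
    repeat split; auto; lra.
  + right; exists (Z.to_nat a); unfold P; rewrite Ea, EA; split; [apply in_seq; lia|].
    repeat split; auto; lra.
- assert (L1 := sum_inv_ln n (N - n) Hn0).
  assert (L2 := sum_inv_root3_fourth n (N - n) Hn0).
  assert (Hlw : 0 <= ln w) by (rewrite <- ln_1; apply ln_le_mono; lra).
  assert (Hln : ln (INR (n + (N - n))) - ln (INR n) <= ln w).
  { assert (0 <= ln (INR n)) by (rewrite <- ln_1; apply ln_le_mono; lra).
    destruct (le_lt_dec n N) as [Hle | Hgt].
    - replace (n + (N - n))%nat with N by lia.
      assert (INR n <= INR N) by now apply le_INR.
      assert (ln (INR N) <= ln w) by (apply ln_le_mono; lra). lra.
    - replace (n + (N - n))%nat with n by lia; lra. }
  assert (Hroot : 0.66 * kap <= root 3 (INR n)).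
  { apply (pow_le_cancel 3); [lia | left; apply root_pos |].
    rewrite root_pow by (lia || lra); rewrite Rpow_mult_distr; lra. }
  assert (Hr3 : 3 / root 3 (INR n) <= 3 / 0.66 * / kap).
  { replace (3 / 0.66 * / kap) with (3 * / (0.66 * kap)) by (field; lra).
    apply Rmult_le_compat_l; [lra|]; apply Rinv_le_contravar; lra. }
  assert (X1 : INR n * (2.05 * (w * (8 / 27) ^ 3 / kap ^ 3) + 9.4 * h * (2 / 3 / kap ^ 4))
    <= 8 / 27 * kap ^ 3
       * (2.05 * (w * (8 / 27) ^ 3 / kap ^ 3) + 9.4 * h * (2 / 3 / kap ^ 4))).
  { apply Rmult_le_compat_r; [|lra].
    assert (0 < w * (8 / 27) ^ 3 / kap ^ 3).
    { apply Rdiv_lt_0_compat; [apply Rmult_lt_0_compat|]; lra. }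
    assert (0 < h * (2 / 3 / kap ^ 4)).
    { apply Rmult_lt_0_compat; [|apply Rdiv_lt_0_compat]; lra. }
    lra. }
  replace (8 / 27 * kap ^ 3
       * (2.05 * (w * (8 / 27) ^ 3 / kap ^ 3) + 9.4 * h * (2 / 3 / kap ^ 4)))
    with (2.05 * (8 / 27) ^ 4 * w + 9.4 * (16 / 81) * (h * / kap)) in X1
    by (unfold Rdiv; field; lra).
  assert (X2 : 2.05 * w * (8 / 27) ^ 4 * Rlist_sum (fun i => / INR i) (seq (S n) (N - n))
    <= 2.05 * w * (8 / 27) ^ 4 * ln w) by (apply Rmult_le_compat_l; lra).
  assert (X3 : 9.4 * h * (2 / 3) ^ 5
      * Rlist_sum (fun i => / root 3 (INR i) ^ 4) (seq (S n) (N - n))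
    <= 9.4 * h * (2 / 3) ^ 5 * (3 / 0.66 * / kap)) by (apply Rmult_le_compat_l; lra).
  assert (0 < h * / kap) by (apply Rmult_lt_0_compat; [|apply Rinv_0_lt_compat]; lra).
  assert (0 <= w * ln w) by (apply Rmult_le_pos; lra).
  (* 2.05 (8/27)^4 < 0.016; the coefficient of h / kap is 9.4 (16/81 + (32/243) * 3 / 0.66) <
     7.6. *)
  unfold Rdiv in *; lra.
Qed.

(** * Isolated points and the middle range *)

Lemma ln_one_plus (y : R) : 0 < y -> y / (1 + y) <= ln (1 + y).
Proof.
intros Hy.
assert (H := exp_ineq1_le (- ln (1 + y))).
rewrite exp_Ropp, exp_ln in H by lra.
replace (y / (1 + y)) with (1 - / (1 + y)) by (field; lra); lra.
Qed.

(** The next point after an isolated u is beyond u (1 + (8/27) / w), so ln u grows by nearly (8/27)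
    / w; 3.39 is slightly above 27/8. All of ln u lies between ln w and 2 ln w. *)
Lemma isolated_count (w T : R) (Q : Z -> Prop) :
  2400 <= w -> w <= T -> (forall u, Q u -> T < IZR u <= w ^ 2) ->
  at_most (fun u => Q u /\
      ~ exists a, (0 < a)%Z /\ IZR a * w <= 8 / 27 * IZR u /\ Q u /\ Q (u + a)%Z)
    (1 + 3.39 * w * ln w).
Proof.
intros Hw HT HQ.
assert (Hlw : 0 <= ln w) by (rewrite <- ln_1; apply ln_le_mono; lra).
assert (0 <= w * ln w) by (apply Rmult_le_pos; lra).
replace (1 + 3.39 * w * ln w) with (1 + (3.39 * w * (2 * ln w) - 3.39 * w * ln w)) by ring.
apply at_most_potential1 with (phi := fun u => 3.39 * w * ln (IZR u)).
- lra.
- intros u [Qu _]; specialize (HQ u Qu).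
  replace (2 * ln w) with (ln (w ^ 2)) by (rewrite <- Rpower_pow, ln_Rpower by lra; simpl; ring).
  split; apply Rmult_le_compat_l; try lra; apply ln_le_mono; lra.
- intros u v [Qu Lu] [Qv _] Huv.
  destruct (HQ u Qu) as [HuT Huw].
  assert (Hgap : 8 / 27 * IZR u < (IZR v - IZR u) * w).
  { apply Rnot_le_lt; intros Hle; apply Lu; exists (v - u)%Z; rewrite minus_IZR.
    repeat split; auto; [lia|]; replace (u + (v - u))%Z with v by lia; auto. }
  set (y := 8 / 27 / w).
  assert (Hy : 0 < y <= 0.0002).
  { unfold y; split; [apply Rdiv_lt_0_compat; lra|].
    apply Rmult_le_reg_r with w; [lra|]; unfold Rdiv at 1.
    rewrite Rmult_assoc, Rinv_l by lra; lra. }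
  assert (Hwy : w * y = 8 / 27) by (unfold y; field; lra).
  assert (Hv : IZR u * (1 + y) <= IZR v).
  { apply Rmult_le_reg_r with w; [lra|].
    replace (IZR u * (1 + y) * w) with (IZR u * w + IZR u * (w * y)) by ring.
    rewrite Hwy; lra. }
  assert (L1 : ln (IZR u) + ln (1 + y) <= ln (IZR v)).
  { rewrite <- ln_mult by lra; apply ln_le_mono; auto; apply Rmult_lt_0_compat; lra. }
  assert (L2 := ln_one_plus y ltac:(lra)).
  assert (L3 : 0.999 * y <= y / (1 + y)).
  { apply Rmult_le_reg_r with (1 + y); [lra|].
    replace (y / (1 + y) * (1 + y)) with (y * 1) by (field; lra).
    rewrite Rmult_assoc, (Rmult_comm 0.999), Rmult_assoc; apply Rmult_le_compat_l; lra. }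
  assert (3.39 * w * (ln (IZR u) + 0.999 * y) <= 3.39 * w * ln (IZR v))
    by (apply Rmult_le_compat_l; lra).
  replace (3.39 * w * (ln (IZR u) + 0.999 * y))
    with (3.39 * w * ln (IZR u) + 3.39 * 0.999 * (w * y)) in * by ring.
  rewrite Hwy in *; lra.
Qed.

(** After thinning to a spaced set (factor 2), each point is isolated or starts a pair. *)
Lemma count_middle (x h w kap : R) :
  regime x h -> 0 < w -> w ^ 5 = x -> 5 <= kap -> 600 * h <= w * kap ^ 3 ->
  at_most (fun u => near x h u /\ w * kap ^ 3 < IZR u <= w ^ 2)
    (2 * (1 + 3.39 * w * ln w + (0.016 * w * (1 + ln w) + 7.6 * h / kap))).
Proof.
intros Hr Hw Hwx Hk HT.
assert (Hw' : 2400 <= w).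
{ apply (pow_le_cancel 5); [lia | lra |]; destruct Hr; lra. }
assert (Hh : 20000 <= h) by (destruct Hr; lra).
assert (Hk3 : 125 <= kap ^ 3).
{ replace 125 with (5 ^ 3) by ring; apply pow_incr; lra. }
assert (HwT : w <= w * kap ^ 3).
{ rewrite <- (Rmult_1_r w) at 1; apply Rmult_le_compat_l; lra. }
apply at_most_alternate with (Rel := spaced x).
{ intros u v y [Nu Hu] [Nv Hv] [Ny Hy] Huvy.
  apply near_three with h v; auto; lra. }
intros Q HQ HQs.
assert (Hsn : spaced_near x h (w * kap ^ 3) Q).
{ split; auto; intros u Qu; destruct (HQ u Qu) as [Nu Hu]; split; auto; lra. }
assert (H1 := pairs_total x h w kap Q Hr Hw Hwx Hk HT Hsn
  (fun u Qu => proj2 (proj2 (HQ u Qu)))).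
assert (H2 := isolated_count w (w * kap ^ 3) Q Hw' HwT (fun u Qu => proj2 (HQ u Qu))).
eapply at_most_mono; [| apply Rle_refl | exact (at_most_or _ _ _ _ H2 H1)].
intros u Qu.
destruct (classic (exists a, (0 < a)%Z /\ IZR a * w <= 8 / 27 * IZR u /\ Q u /\ Q (u + a)%Z));
  auto.
Qed.

(** * Numerical estimates *)

Lemma exp_double (y a b : R) :
  0 <= a -> a <= exp (y / 2) <= b -> a ^ 2 <= exp y <= b ^ 2.
Proof.
intros Ha Hy.
replace (exp y) with (exp (y / 2) ^ 2)
  by (simpl; rewrite Rmult_1_r, <- exp_plus; f_equal; field).
split; apply pow_incr; lra.
Qed.

(* Starting from 1 + y <= exp y <= 1 / (1 - y) at y = 2^(-10) and squaring ten times. *)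
Lemma exp_1_bounds : 2.716 <= exp 1 <= 2.72.
Proof.
assert (H : 500488281 / 500000000 <= exp (/ 1024) <= 500488759 / 500000000).
{ split.
  - assert (H := exp_ineq1_le (/ 1024)); lra.
  - assert (H := exp_ineq1_le (- / 1024)); rewrite exp_Ropp in H.
    assert (Hp := exp_pos (/ 1024)).
    apply Rmult_le_compat_l with (r := exp (/ 1024)) in H; [|lra].
    rewrite Rinv_r in H by lra; lra. }
assert (H9 : 1001954077 / 1000000000 <= exp (/ 512) <= 125244499 / 125000000)
  by (assert (X := exp_double (/ 512) (500488281 / 500000000) (500488759 / 500000000) ltac:(lra)
    ltac:(replace (/ 512 / 2) with (/ 1024) by field; lra)); lra).
assert (H8 : 250977993 / 250000000 <= exp (/ 256) <= 100391581 / 100000000)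
  by (assert (X := exp_double (/ 256) (1001954077 / 1000000000) (125244499 / 125000000) ltac:(lra)
    ltac:(replace (/ 256 / 2) with (/ 512) by field; lra)); lra).
assert (H7 : 1007839247 / 1000000000 <= exp (/ 128) <= 503923477 / 500000000)
  by (assert (X := exp_double (/ 128) (250977993 / 250000000) (100391581 / 100000000) ltac:(lra)
    ltac:(replace (/ 128 / 2) with (/ 256) by field; lra)); lra).
assert (H6 : 1015739947 / 1000000000 <= exp (/ 64) <= 1015755483 / 1000000000)
  by (assert (X := exp_double (/ 64) (1007839247 / 1000000000) (503923477 / 500000000) ltac:(lra)
    ltac:(replace (/ 64 / 2) with (/ 128) by field; lra)); lra).
assert (H5 : 1031727639 / 1000000000 <= exp (/ 32) <= 515879601 / 500000000)
  by (assert (X := exp_double (/ 32) (1015739947 / 1000000000) (1015755483 / 1000000000) ltac:(lra)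
    ltac:(replace (/ 32 / 2) with (/ 64) by field; lra)); lra).
assert (H4 : 1064461921 / 1000000000 <= exp (/ 16) <= 1064527051 / 1000000000)
  by (assert (X := exp_double (/ 16) (1031727639 / 1000000000) (515879601 / 500000000) ltac:(lra)
    ltac:(replace (/ 16 / 2) with (/ 32) by field; lra)); lra).
assert (H3 : 1133079181 / 1000000000 <= exp (/ 8) <= 1133217843 / 1000000000)
  by (assert (X := exp_double (/ 8) (1064461921 / 1000000000) (1064527051 / 1000000000) ltac:(lra)
    ltac:(replace (/ 8 / 2) with (/ 16) by field; lra)); lra).
assert (H2 : 128386843 / 100000000 <= exp (/ 4) <= 32104567 / 25000000)
  by (assert (X := exp_double (/ 4) (1133079181 / 1000000000) (1133217843 / 1000000000) ltac:(lra)
    ltac:(replace (/ 4 / 2) with (/ 8) by field; lra)); lra).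
assert (H1 : 329663629 / 200000000 <= exp (/ 2) <= 412281289 / 250000000)
  by (assert (X := exp_double (/ 2) (128386843 / 100000000) (32104567 / 25000000) ltac:(lra)
    ltac:(replace (/ 2 / 2) with (/ 4) by field; lra)); lra).
assert (H0 : 2716952707 / 1000000000 <= exp (1) <= 2719613781 / 1000000000)
  by (assert (X := exp_double (1) (329663629 / 200000000) (412281289 / 250000000) ltac:(lra)
    ltac:(replace (1 / 2) with (/ 2) by field; lra)); lra).
lra.
Qed.

(** Reduces bounds for exp at rationals to comparing rational powers. *)
Lemma exp_rational (p q : nat) : (0 < q)%nat -> exp (INR p / INR q) ^ q = exp 1 ^ p.
Proof.
intros Hq.
assert (Hq0 : INR q <> 0) by (apply not_0_INR; lia).
rewrite <- !Rpower_pow by apply exp_pos.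
unfold Rpower; rewrite !ln_exp; f_equal; field; auto.
Qed.

Lemma exp_rational_le (p q : nat) (c : R) : (0 < q)%nat -> 0 <= c -> 2.72 ^ p <= c ^ q ->
  exp (INR p / INR q) <= c.
Proof.
intros Hq Hc H; apply (pow_le_cancel q); auto.
rewrite exp_rational by auto.
apply Rle_trans with (2 := H); apply pow_incr; assert (E := exp_1_bounds); lra.
Qed.

Lemma exp_rational_ge (p q : nat) (c : R) : (0 < q)%nat -> c ^ q <= 2.716 ^ p ->
  c <= exp (INR p / INR q).
Proof.
intros Hq H; apply (pow_le_cancel q); auto; [left; apply exp_pos|].
rewrite exp_rational by auto.
apply Rle_trans with (1 := H); apply pow_incr; assert (E := exp_1_bounds); lra.
Qed.

Lemma exp_tangent (a y : R) : exp a * (1 + (y - a)) <= exp y.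
Proof.
replace (exp y) with (exp a * exp (y - a)) by (rewrite <- exp_plus; f_equal; ring).
apply Rmult_le_compat_l; [left; apply exp_pos | apply exp_ineq1_le].
Qed.

(** Convexity: the tangent at y, evaluated at 0 and S, averaged with weights S - y and y. *)
Lemma exp_chord (y S : R) : 0 <= y <= S -> 0 < S -> exp y <= 1 + y * ((exp S - 1) / S).
Proof.
intros Hy HS.
assert (H1 := exp_tangent y S); assert (H0 := exp_tangent y 0); rewrite exp_0 in H0.
apply Rmult_le_reg_l with S; auto.
replace (S * (1 + y * ((exp S - 1) / S))) with ((S - y) * 1 + y * exp S) by (field; lra).
assert ((S - y) * (exp y * (1 + (0 - y))) <= (S - y) * 1) by (apply Rmult_le_compat_l; lra).
assert (y * (exp y * (1 + (S - y))) <= y * exp S) by (apply Rmult_le_compat_l; lra).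
lra.
Qed.

(** Mostly values at the endpoints 18, 42, 91 and 140 of the ranges of t = ln x, where tangents and
    chords are anchored. *)
Lemma numeric_constants :
  198 <= exp 5.4 <= 223 /\ 4000 <= exp 8.4 /\ 254.3 <= exp 5.6 <= 273 /\
  exp 4.55 <= 96 /\ 7e7 <= exp 18.2 /\ exp (91 / 15) <= 435 /\ exp (49 / 15) <= 26.6 /\
  1000 <= exp 7 /\ exp 3 <= 21.
Proof.
replace 5.4 with (INR 27 / INR 5) by (simpl; lra).
replace 8.4 with (INR 42 / INR 5) by (simpl; lra).
replace 5.6 with (INR 28 / INR 5) by (simpl; lra).
replace 4.55 with (INR 91 / INR 20) by (rewrite !INR_IZR_INZ; simpl; lra).
replace 18.2 with (INR 91 / INR 5) by (rewrite !INR_IZR_INZ; simpl; lra).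
replace (91 / 15) with (INR 91 / INR 15) by (rewrite !INR_IZR_INZ; simpl; lra).
replace (49 / 15) with (INR 49 / INR 15) by (rewrite !INR_IZR_INZ; simpl; lra).
replace (exp 7) with (exp (INR 7 / INR 1)) by (f_equal; simpl; lra).
replace (exp 3) with (exp (INR 3 / INR 1)) by (f_equal; simpl; lra).
repeat split; first [apply exp_rational_le; [lia | lra | lra] | apply exp_rational_ge; [lia | lra]].
Qed.

Lemma exp_pow (k : nat) (y z : R) : z = INR k * y -> exp y ^ k = exp z.
Proof.
intros ->; rewrite <- Rpower_pow by apply exp_pos.
unfold Rpower; now rewrite ln_exp.
Qed.

(** * The theorem on successive ranges of ln x *)

Definition has_squarefree (x h : R) : Prop := exists n : Z, x < IZR n <= x + h /\ squarefree n.

Lemma squarefree_small (n : Z) :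
  (0 < n < 25)%Z -> (n mod 4 <> 0)%Z -> (n mod 9 <> 0)%Z -> squarefree n.
Proof.
intros Hn H4 H9 p Hp [k Hk].
assert (H2 := prime_ge_2 p Hp).
assert (Hk1 : (0 < k)%Z) by nia.
assert (p < 5)%Z by nia.
assert (p = 2 \/ p = 3 \/ p = 4)%Z as [-> | [-> | ->]] by lia.
- apply H4; rewrite Hk; change (2 ^ 2)%Z with 4%Z; now apply Z.mod_mul.
- apply H9; rewrite Hk; change (3 ^ 2)%Z with 9%Z; now apply Z.mod_mul.
- apply H4; rewrite Hk; replace (k * 4 ^ 2)%Z with (k * 4 * 4)%Z by lia; now apply Z.mod_mul.
Qed.

(** The witness is 7 for x < 7 and 23 from there on. *)
Lemma has_squarefree_tiny (t : R) : 2 <= exp t < 23 ->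
  has_squarefree (exp t) (11 * exp (t / 5) * t).
Proof.
intros Ht.
assert (Ht2 : / 2 < t).
{ apply Rlt_le_trans with (ln 2); [apply ln_lt_2|].
  rewrite <- (ln_exp t); apply ln_le_mono; lra. }
assert (Hw := exp_ineq1_le (t / 5)).
destruct (Rlt_le_dec (exp t) 7) as [Hlt | Hge].
- exists 7%Z; split; [|apply squarefree_small; easy].
  assert (11 * (1 + t / 5) * t <= 11 * exp (t / 5) * t) by (apply Rmult_le_compat_r; lra).
  split; [lra | nra].
- assert (Ht3 : 1.5 <= t).
  { apply Rnot_lt_le; intros Hc.
    destruct numeric_constants as (_ & _ & _ & _ & _ & _ & _ & _ & H3).
    assert (H := exp_pow 2 1.5 3 ltac:(simpl; lra)).
    assert (exp t < exp 1.5) by now apply exp_increasing.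
    nra. }
  exists 23%Z; split; [|apply squarefree_small; easy].
  assert (11 * (1 + t / 5) * t <= 11 * exp (t / 5) * t) by (apply Rmult_le_compat_r; lra).
  split; [lra | nra].
Qed.

(** Sieving by all primes up to sqrt (x + h) leaves no near point above z; a chord bounds sqrt x by
    w (1 + 12.34 t). *)
Lemma has_squarefree_small (t : R) : 23 <= exp t -> t <= 18 ->
  has_squarefree (exp t) (11 * exp (t / 5) * t).
Proof.
intros H23 H18.
destruct numeric_constants as ([_ C1] & _ & _ & _ & _ & _ & _ & _ & C3).
assert (Ht : 3 <= t).
{ apply Rnot_lt_le; intros Hc.
  assert (exp t < exp 3) by now apply exp_increasing. lra. }
assert (Hw : 1.69 <= exp (t / 5)).
{ assert (H := exp_ineq1_le (t / 10)).
  assert (E := exp_pow 2 (t / 10) (t / 5) ltac:(simpl; lra)).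
  rewrite <- E; nra. }
assert (Hch := exp_chord (0.3 * t) 5.4 ltac:(lra) ltac:(lra)).
assert (E2 := exp_pow 2 (t / 2) t ltac:(simpl; lra)).
assert (Es : exp (t / 2) = exp (t / 5) * exp (0.3 * t)).
{ rewrite <- exp_plus; f_equal; lra. }
set (w := exp (t / 5)) in *; set (h := 11 * w * t) in *; set (x := exp t) in *.
assert (Hh : 55 <= h) by (unfold h; nra).
set (z := sqrt (x + h)).
assert (Hz2 : z ^ 2 = x + h) by (apply pow2_sqrt; lra).
assert (Hz0 : 0 <= z) by apply sqrt_pos.
assert (Hsx := exp_pos (t / 2)).
set (sx := exp (t / 2)) in *.
assert (Hz : z <= sx + h / 20 + 5) by (apply (pow_le_cancel 2); [lia | lra | nra]).
unfold has_squarefree; apply sieve with (z := z) (B := 0).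
- lra.
- lra.
- apply (pow_le_cancel 2); [lia | lra | rewrite Hz2; lra].
- rewrite Hz2; lra.
- apply at_most_false; intros u [Nu Hu].
  assert (H := near_sq_le x h u ltac:(lra) Nu).
  assert (z ^ 2 < IZR u ^ 2) by (apply pow_lt_mono; [lia | lra]); lra.
- assert (sx <= w * (1 + 12.34 * t * 1)).
  { rewrite Es; apply Rmult_le_compat_l; [lra|].
    assert ((exp 5.4 - 1) / 5.4 <= 41.12) by lra.
    assert (0.3 * t * ((exp 5.4 - 1) / 5.4) <= 0.3 * t * 41.12)
      by (apply Rmult_le_compat_l; lra).
    lra. }
  assert (1.69 * 3 <= w * t) by (apply Rmult_le_compat; lra).
  assert (w * 3 <= w * t) by (apply Rmult_le_compat_l; lra).
  unfold h in *; lra.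
Qed.

(** With z = 2 x^(1/3), both the sieve and the two-point count are of order x^(1/3), at most w (1 +
    6.48 t). *)
Lemma has_squarefree_medium (t : R) : 18 <= t <= 42 ->
  has_squarefree (exp t) (11 * exp (t / 5) * t).
Proof.
intros Ht.
destruct numeric_constants as ([C1 _] & C2 & [_ C3] & _).
assert (Hw : 1 + t / 5 <= exp (t / 5)) by apply exp_ineq1_le.
assert (Hx := exp_pow 5 (t / 5) t ltac:(simpl; lra)).
assert (Hch := exp_chord (2 * t / 15) 5.6 ltac:(lra) ltac:(lra)).
assert (Er : exp (t / 3) = exp (t / 5) * exp (2 * t / 15)).
{ rewrite <- exp_plus; f_equal; lra. }
assert (E3 := exp_pow 3 (t / 3) t ltac:(simpl; lra)).
assert (Er2 : exp (t / 3) ^ 2 = exp (t / 5) * exp (7 * t / 15)).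
{ rewrite (exp_pow 2 _ (2 * t / 3)) by (simpl; lra); rewrite <- exp_plus; f_equal; lra. }
assert (Ew3 := exp_pow 2 (0.3 * t) (3 * (t / 5)) ltac:(simpl; lra)).
assert (Ew3' := exp_pow 3 (t / 5) (3 * (t / 5)) ltac:(simpl; lra)).
assert (T7 := exp_tangent 8.4 (7 * t / 15)).
assert (T3 := exp_tangent 5.4 (0.3 * t)).
set (w := exp (t / 5)) in *; set (h := 11 * w * t) in *.
set (r := exp (t / 3)) in *.
assert (H7 : 137.5 * t <= exp (7 * t / 15)) by nra.
assert (H3 : 11 * t <= exp (0.3 * t)) by nra.
assert (Hr : 7 <= r) by (assert (H := exp_ineq1_le (t / 3)); unfold r; lra).
assert (Hh : 1 <= h) by (unfold h; nra).
assert (Hhr : h <= 0.08 * r ^ 2).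
{ rewrite Er2; unfold h; assert (w * (137.5 * t) <= w * exp (7 * t / 15))
    by (apply Rmult_le_compat_l; lra). lra. }
assert (Hhx : h ^ 2 <= exp t).
{ rewrite <- Hx; unfold h; replace ((11 * w * t) ^ 2) with (w ^ 2 * (11 * t) ^ 2) by ring.
  replace (w ^ 5) with (w ^ 2 * w ^ 3) by ring.
  apply Rmult_le_compat_l; [nra|]; rewrite Ew3', <- Ew3; apply pow_incr; lra. }
unfold has_squarefree; apply sieve with (z := 2 * r) (B := 1 + exp t / (2 * r) ^ 2 / 0.98).
- apply exp_pos.
- lra.
- lra.
- lra.
- apply count_two; try lra; [apply exp_pos | nra].
- replace (exp t / (2 * r) ^ 2) with (r / 4) by (rewrite <- E3; field; lra).
  assert (r <= w * (1 + 6.48 * t)).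
  { rewrite Er; apply Rmult_le_compat_l; [lra|].
    assert (2 * t / 15 * ((exp 5.6 - 1) / 5.6) <= 2 * t / 15 * 48.6)
      by (apply Rmult_le_compat_l; lra).
    lra. }
  assert (4 * 18 <= w * t) by (apply Rmult_le_compat; lra).
  assert (w * 18 <= w * t) by (apply Rmult_le_compat_l; lra).
  unfold h; lra.
Qed.

Lemma regime_large (t : R) : 42 <= t ->
  4000 <= exp (t / 5) /\ regime (exp t) (11 * exp (t / 5) * t).
Proof.
intros Ht.
destruct numeric_constants as (_ & C2 & [C3 _] & _).
assert (Hx := exp_pow 5 (t / 5) t ltac:(simpl; lra)).
assert (E6 := exp_pow 3 (2 * t / 15) (2 * (t / 5)) ltac:(simpl; lra)).
assert (E2 := exp_pow 2 (t / 5) (2 * (t / 5)) ltac:(simpl; lra)).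
assert (T1 := exp_tangent 8.4 (t / 5)).
assert (T2 := exp_tangent 5.6 (2 * t / 15)).
assert (Hw : 4000 <= exp (t / 5)) by nra.
assert (Hv : 6.054 * t <= exp (2 * t / 15)) by nra.
set (w := exp (t / 5)) in *.
split; auto; repeat split.
- nra.
- rewrite <- Hx.
  assert (Hv3 : (6.054 * t) ^ 3 <= w ^ 2) by (rewrite E2, <- E6; apply pow_incr; lra).
  assert (Hw3 : 0 < w ^ 3) by (apply pow_lt; lra).
  assert (Ht3 : 0 < t ^ 3) by (apply pow_lt; lra).
  replace ((11 * w * t) ^ 3) with (w ^ 3 * (1331 * t ^ 3)) by ring.
  replace (6 * w ^ 5) with (w ^ 3 * (6 * w ^ 2)) by ring.
  apply Rmult_le_compat_l; lra.
- rewrite <- Hx; apply Rle_trans with (4000 ^ 5); [lra | apply pow_incr; lra].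
Qed.

(** From z = h/4 on, the three-point count suffices as long as w <= 2 t^4. *)
Lemma has_squarefree_large (t : R) : 42 <= t <= 91 ->
  has_squarefree (exp t) (11 * exp (t / 5) * t).
Proof.
intros Ht.
destruct numeric_constants as (_ & _ & _ & C4 & _).
destruct (regime_large t ltac:(lra)) as [Hw Hr].
assert (Hx := exp_pow 5 (t / 5) t ltac:(simpl; lra)).
assert (E4 := exp_pow 4 (t / 20) (t / 5) ltac:(simpl; lra)).
assert (Hch := exp_chord (t / 20) 4.55 ltac:(lra) ltac:(lra)).
assert (He := exp_pos (t / 20)).
set (w := exp (t / 5)) in *; set (h := 11 * w * t) in *.
assert (Hh : 20000 <= h) by (destruct Hr; lra).
assert (Hw4 : w <= 2 * t ^ 4).
{ assert (exp (t / 20) <= 1.189 * t).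
  { assert (t / 20 * ((exp 4.55 - 1) / 4.55) <= t / 20 * 20.9)
      by (apply Rmult_le_compat_l; lra).
    lra. }
  assert (exp (t / 20) ^ 4 <= (1.189 * t) ^ 4) by (apply pow_incr; lra).
  assert (0 < t ^ 4) by (apply pow_lt; lra). lra. }
unfold has_squarefree; apply sieve with (z := h / 4)
  (B := 2 * (1 + 2.86 * root 3 (exp t / (h / 4)))).
- apply exp_pos.
- lra.
- lra.
- nra.
- apply count_three; auto; lra.
- assert (Hroot : root 3 (exp t / (h / 4)) <= 0.9 * (w * t)).
  { apply (pow_le_cancel 3); [lia | nra |].
    rewrite root_pow by (lia || (apply Rdiv_lt_0_compat; [apply exp_pos | lra])).
    apply Rmult_le_reg_r with (h / 4); [lra|].
    unfold Rdiv at 1; rewrite Rmult_assoc, Rinv_l, Rmult_1_r by lra.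
    rewrite <- Hx; unfold h.
    replace ((0.9 * (w * t)) ^ 3 * (11 * w * t / 4)) with (w ^ 4 * (0.9 ^ 3 * 11 / 4 * t ^ 4))
      by field.
    replace (w ^ 5) with (w ^ 4 * w) by ring.
    apply Rmult_le_compat_l; [apply pow_le|]; lra. }
  assert (4000 * 42 <= w * t) by (apply Rmult_le_compat; lra).
  unfold h in *; lra.
Qed.

(** Four points are used up to T = 16^6 w, costing about 400 w, and three points above it. *)
Lemma has_squarefree_larger (t : R) : 91 <= t <= 140 ->
  has_squarefree (exp t) (11 * exp (t / 5) * t).
Proof.
intros Ht.
destruct numeric_constants as (_ & _ & _ & _ & C5 & C6 & C7 & _).
destruct (regime_large t ltac:(lra)) as [Hw Hr].
assert (Hx := exp_pow 5 (t / 5) t ltac:(simpl; lra)).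
assert (E3 := exp_pow 3 (t / 15) (t / 5) ltac:(simpl; lra)).
assert (T1 := exp_tangent 18.2 (t / 5)).
assert (Hch := exp_chord ((t - 91) / 15) (49 / 15) ltac:(lra) ltac:(lra)).
assert (Es : exp (t / 15) = exp (91 / 15) * exp ((t - 91) / 15)).
{ rewrite <- exp_plus; f_equal; lra. }
set (w := exp (t / 5)) in *; set (h := 11 * w * t) in *.
assert (Hh : 20000 <= h) by (destruct Hr; lra).
assert (Hwt : 713000 * t <= w) by nra.
set (T := 16 ^ 6 * w).
assert (HT : 0 < T) by (unfold T; lra).
assert (HhT : h ^ 2 * T <= 0.004 * exp t).
{ rewrite <- Hx; unfold h, T.
  replace ((11 * w * t) ^ 2 * (16 ^ 6 * w)) with (w ^ 3 * (121 * 16 ^ 6 * t ^ 2)) by ring.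
  replace (0.004 * w ^ 5) with (w ^ 3 * (0.004 * w ^ 2)) by ring.
  apply Rmult_le_compat_l; [apply pow_le; lra|].
  assert ((713000 * t) ^ 2 <= w ^ 2) by (apply pow_incr; lra).
  assert (0 < t ^ 2) by (apply pow_lt; lra). lra. }
assert (B1 := count_four (exp t) h w (h / 4) T Hr ltac:(lra) Hx ltac:(lra) HT HhT).
assert (B2 := count_three (exp t) h T Hr ltac:(unfold T, h; nra)).
assert (R6 : root 6 (T / w) <= 16).
{ apply (pow_le_cancel 6); [lia | lra |].
  rewrite root_pow by (lia || (apply Rdiv_lt_0_compat; lra)).
  right; unfold T; field; lra. }
assert (R3 : root 3 (exp t / T) <= w * (exp (t / 15) / 256)).
{ assert (He := exp_pos (t / 15)).
  apply (pow_le_cancel 3); [lia | apply Rmult_le_pos; lra |].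
  rewrite root_pow by (lia || (apply Rdiv_lt_0_compat; [apply exp_pos | lra])).
  right; rewrite <- Hx; unfold T.
  replace ((w * (exp (t / 15) / 256)) ^ 3) with (w ^ 3 * exp (t / 15) ^ 3 / 16777216) by field.
  rewrite E3; field; lra. }
assert (B := at_most_or _ _ _ _ B1 B2).
unfold has_squarefree; eapply sieve with (z := h / 4); [apply exp_pos | lra | lra | nra | |].
- eapply at_most_mono; [| apply Rle_refl | exact B].
  intros u [Nu Hu]; destruct (Rle_lt_dec (IZR u) T); [left | right]; auto.
- assert (Q1 : exp (t / 15) <= 435 * (1 + (t - 91) / 15 * 7.84)).
  { rewrite Es; apply Rmult_le_compat; try (left; apply exp_pos); try lra.
    assert ((t - 91) / 15 * ((exp (49 / 15) - 1) / (49 / 15)) <= (t - 91) / 15 * 7.84)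
      by (apply Rmult_le_compat_l; lra).
    lra. }
  assert (Q2 : w * (exp (t / 15) / 256) <= w * (435 * (1 + (t - 91) / 15 * 7.84) / 256))
    by (apply Rmult_le_compat_l; lra).
  assert (Q3 : w / 0.24 * root 6 (T / w) <= w / 0.24 * 16)
    by (apply Rmult_le_compat_l; lra).
  assert (w * 91 <= w * t) by (apply Rmult_le_compat_l; lra).
  unfold h; lra.
Qed.

(** In units of w t, the four-point count costs 2.5, isolated points 1.36 and pairs 0.86; the budget
    is 11 (1 - 0.4585 - 1/15), about 5.22. *)
Lemma has_squarefree_largest (t : R) : 140 <= t ->
  has_squarefree (exp t) (11 * exp (t / 5) * t).
Proof.
intros Ht.
destruct numeric_constants as (_ & _ & _ & _ & _ & _ & _ & C8 & _).
destruct (regime_large t ltac:(lra)) as [Hw Hr].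
assert (Hx := exp_pow 5 (t / 5) t ltac:(simpl; lra)).
assert (E4 := exp_pow 4 (t / 20) (t / 5) ltac:(simpl; lra)).
assert (T1 := exp_tangent 7 (t / 20)).
assert (Hlw : ln (exp (t / 5)) = t / 5) by apply ln_exp.
set (w := exp (t / 5)) in *; set (h := 11 * w * t) in *.
assert (Hh : 20000 <= h) by (destruct Hr; lra).
assert (Ht4 : 0 < t ^ 4) by (apply pow_lt; lra).
assert (Hwt : 0.18 * t ^ 4 <= w).
{ assert (H : 0.66 * t <= exp (t / 20)) by nra.
  assert ((0.66 * t) ^ 4 <= exp (t / 20) ^ 4) by (apply pow_incr; lra). lra. }
(* This makes (T / w)^(1/6) = t/10, so the four-point count is linear in t, and h / kap is small
   compared with h. *)
set (kap := (t / 10) ^ 2).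
assert (Hkap : 196 <= kap) by (unfold kap; nra).
set (T := w * kap ^ 3).
assert (HT0 : 0 < T) by (apply Rmult_lt_0_compat; [|apply pow_lt]; lra).
assert (HhT : h ^ 2 * T <= 0.004 * exp t).
{ rewrite <- Hx; unfold h, T, kap.
  replace ((11 * w * t) ^ 2 * (w * ((t / 10) ^ 2) ^ 3))
    with (w ^ 3 * (121 / 1000000 * (t ^ 4) ^ 2)) by field.
  replace (0.004 * w ^ 5) with (w ^ 3 * (0.004 * w ^ 2)) by ring.
  apply Rmult_le_compat_l; [apply pow_le; lra|].
  assert ((0.18 * t ^ 4) ^ 2 <= w ^ 2) by (apply pow_incr; lra).
  assert (0 <= (t ^ 4) ^ 2) by (apply pow_le; lra). lra. }
assert (H600 : 600 * h <= T).
{ unfold h, T, kap.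
  replace (600 * (11 * w * t)) with (w * t * 6600) by ring.
  replace (w * ((t / 10) ^ 2) ^ 3) with (w * t * (t ^ 5 / 1000000)) by field.
  apply Rmult_le_compat_l; [apply Rmult_le_pos; lra|].
  assert (140 ^ 5 <= t ^ 5) by (apply pow_incr; lra). lra. }
assert (B1 := count_four (exp t) h w (h / 4) T Hr ltac:(lra) Hx ltac:(lra) HT0 HhT).
assert (B2 := count_middle (exp t) h w kap Hr ltac:(lra) Hx ltac:(lra) H600).
fold T in B2; rewrite Hlw in B2.
assert (Hw2 : h / 4 <= w ^ 2).
{ unfold h; replace (w ^ 2) with (w * w) by ring.
  replace (11 * w * t / 4) with (w * (11 / 4 * t)) by field.
  apply Rmult_le_compat_l; [lra|].
  assert (140 ^ 3 * t <= t ^ 3 * t)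
    by (apply Rmult_le_compat_r; [lra | apply pow_incr; lra]). lra. }
assert (B3 := count_three (exp t) h (w ^ 2) Hr Hw2).
assert (R6 : root 6 (T / w) <= t / 10).
{ apply (pow_le_cancel 6); [lia | lra |].
  rewrite root_pow by (lia || (apply Rdiv_lt_0_compat; lra)).
  right; unfold T, kap; field; lra. }
assert (R3 : root 3 (exp t / w ^ 2) <= w).
{ apply (pow_le_cancel 3); [lia | lra |].
  rewrite root_pow by (lia || (apply Rdiv_lt_0_compat; [apply exp_pos | apply pow_lt; lra])).
  right; rewrite <- Hx; field; lra. }
assert (B := at_most_or _ _ _ _ B1 (at_most_or _ _ _ _ B2 B3)).
unfold has_squarefree; eapply sieve with (z := h / 4); [apply exp_pos | lra | lra | nra | |].
- eapply at_most_mono; [| apply Rle_refl | exact B].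
  intros u [Nu Hu]; destruct (Rle_lt_dec (IZR u) T); [left; auto | right].
  destruct (Rle_lt_dec (IZR u) (w ^ 2)); [left | right]; auto.
- assert (Q3 : w / 0.24 * root 6 (T / w) <= w / 0.24 * (t / 10))
    by (apply Rmult_le_compat_l; lra).
  assert (Q4 : 7.6 * h / kap <= 0.4266 * (w * t)).
  { apply Rmult_le_reg_r with kap; [lra|].
    replace (7.6 * h / kap * kap) with (7.6 * h) by (field; lra).
    assert (0 <= w * t) by (apply Rmult_le_pos; lra).
    unfold h; assert (w * t * 196 <= w * t * kap)
      by (apply Rmult_le_compat_l; [apply Rmult_le_pos |]; lra). lra. }
  assert (w * 140 <= w * t) by (apply Rmult_le_compat_l; lra).
  unfold h in *; lra.
Qed.

Theorem theorem1p1 (x : R) (hx : 2 <= x) :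
  exists n : Z,
    x < IZR n <= x + 11 * Rpower x (1 / 5) * ln x /\ squarefree n.
Proof.
assert (Ex : exp (ln x) = x) by (apply exp_ln; lra).
replace (Rpower x (1 / 5)) with (exp (ln x / 5)) by (unfold Rpower; f_equal; field).
set (t := ln x) in *; rewrite <- Ex in hx |- *.
change (has_squarefree (exp t) (11 * exp (t / 5) * t)).
destruct (Rlt_le_dec (exp t) 23); [apply has_squarefree_tiny; lra|].
destruct (Rle_lt_dec t 18); [apply has_squarefree_small; lra|].
destruct (Rle_lt_dec t 42); [apply has_squarefree_medium; lra|].
destruct (Rle_lt_dec t 91); [apply has_squarefree_large; lra|].
destruct (Rle_lt_dec t 140); [apply has_squarefree_larger; lra|].
apply has_squarefree_largest; lra.
Qed.
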